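(* The following growth and decay estimates hold as $i,j\to+\infty$. (a) For each constant $X_{ij}$ in the list $$\mathbb{C}_{13ji},\ \overline{\mathbb{C}}_{13ji},\ \mathbb{C}_{24ji},\ \overline{\mathbb{C}}_{24ji},\ \mathbb{D}_{13ji},\ \overline{\mathbb{D}}_{13ji},\ \mathbb{D}_{24ji},\ \overline{\mathbb{D}}_{24ji},\ \mathbb{E}_{1423ji},\ \overline{\mathbb{E}}_{1423ji},\ \mathbb{G}_{0ji},\ \mathbb{F}_{10ji},\ \mathbb{F}_{20ji},\ \mathbb{F}_{30ji},\ \mathbb{F}_{40ji}$$ one has $\omega_iX_{ij}=\mathcal{O}(\omega_i)$ if $\omega_i-\omega_j\not\to\infty$, and $$\omega_iX_{ij}=\sum_\pm\mathcal{O}\left(\frac{\omega_i}{(\omega_i\pm\omega_j)^{p}}\right)\quad\text{if }\omega_i-\omega_j\to\infty,$$ where $p=10$ for $\mathbb{F}_{10ji}$, $p=12$ for $\mathbb{F}_{20ji}$, and $p=4$ for all the other constants in the list. (b) For each quantity $Y_{ij}$ in the list $$\omega_0\overline{\mathbb{P}}_{a0ji},\ \frac{\omega_0\mathbb{P}_{a0ji}}{\omega_i}\ (a=1,2,3,4),\qquad \omega_0\overline{\mathbb{J}}_{0ji},\ \frac{\omega_0\mathbb{J}_{0ji}}{\omega_i}$$ one has $Y_{ij}=\mathcal{O}(\omega_i^{-1})$ if $\omega_i-\omega_j\not\to\infty$, and $$Y_{ij}=\frac{1}{\omega_i}\sum_\pm\mathcal{O}\left(\frac{1}{(\omega_i\pm\omega_j)^{p}}\right)\quad\text{if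 }\omega_i-\omega_j\to\infty,$$ where $p=10$ for $\overline{\mathbb{P}}_{10ji},\mathbb{P}_{10ji}$, $p=12$ for $\overline{\mathbb{P}}_{20ji},\mathbb{P}_{20ji}$, and $p=4$ for $\overline{\mathbb{P}}_{30ji},\mathbb{P}_{30ji},\overline{\mathbb{P}}_{40ji},\mathbb{P}_{40ji},\overline{\mathbb{J}}_{0ji},\mathbb{J}_{0ji}$. (c) The following functions $F$ (the weights associated with the Fourier constants named in parentheses after each function) have the following first non-vanishing derivative $F^{(n)}(\pi/2)\neq0$: $n=3$ for $F=\Gamma_1-\Gamma_3$ (constants $\mathbb{C}_{13ji},\overline{\mathbb{C}}_{13ji}$), $\Gamma_2-\Gamma_4$ ($\mathbb{C}_{24ji},\overline{\mathbb{C}}_{24ji}$), $\Gamma_1\Gamma_3$ ($\mathbb{D}_{13ji},\overline{\mathbb{D}}_{13ji}$), $\Gamma_2\Gamma_4$ ($\mathbb{D}_{24ji},\overline{\mathbb{D}}_{24ji}$), $\Gamma_1\Gamma_4+\Gamma_2\Gamma_3$ ($\mathbb{E}_{1423ji},\overline{\mathbb{E}}_{1423ji}$), $e_0$ ($\mathbb{G}_{0ji}$), $\Gamma_3e_0$ ($\mathbb{F}_{30ji}$), $\Gamma_4e_0$ ($\mathbb{F}_{40ji}$), $\Gamma_3e_0'\sin\cos$ ($\mathbb{P}_{30ji},\overline{\mathbb{P}}_{30ji}$), $\Gamma_4e_0'\sin\cos$ ($\mathbb{P}_{40ji},\overline{\mathbb{P}}_{40ji}$), $e_0'\sin\cos$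 ($\mathbb{J}_{0ji},\overline{\mathbb{J}}_{0ji}$); $n=9$ for $F=\Gamma_1e_0$ ($\mathbb{F}_{10ji}$) and $\Gamma_1e_0'\sin\cos$ ($\mathbb{P}_{10ji},\overline{\mathbb{P}}_{10ji}$); $n=11$ for $F=\Gamma_2e_0$ ($\mathbb{F}_{20ji}$) and $\Gamma_2e_0'\sin\cos$ ($\mathbb{P}_{20ji},\overline{\mathbb{P}}_{20ji}$).
   Context: For integers $i\ge 0$ and $x\in[0,\pi/2]$ set $\omega_i:=3+2i$ and $$e_i(x):=2\frac{\sqrt{i!\,(i+2)!}}{\Gamma(i+\frac32)}\cos^3(x)\,P_i^{(\frac12,\frac32)}(\cos(2x)),$$ where $P_i^{(\alpha,\beta)}$ are the Jacobi polynomials (Szegő's normalization); $e_i'$ is the derivative of $e_i$. Let $$\Gamma_1(x):=\frac{\cos^3(x)}{\sin(x)}\int_0^x(e_0'(y))^2\tan^2(y)\,dy,\qquad \Gamma_2(x):=\omega_0^2\frac{\cos^3(x)}{\sin(x)}\int_0^x(e_0(y))^2\tan^2(y)\,dy,$$ $$\Gamma_3(x):=\int_0^x(e_0'(y))^2\sin(y)\cos(y)\,dy,\qquad \Gamma_4(x):=\omega_0^2\int_0^x(e_0(y))^2\sin(y)\cos(y)\,dy.$$ The Fourier constants are (for $a,b\in\{1,2,3,4\}$ and $i,j,k\ge0$) $$\mathbb{C}_{abij}:=\int_0^{\pi/2}(\Gamma_a-\Gamma_b)e_ie_j\tan^2dx,\qquad \overline{\mathbb{C}}_{abij}:=\int_0^{\pi/2}(\Gamma_a-\Gamma_b)\frac{e_i'}{\omega_i}\frac{e_j'}{\omega_j}\tan^2dx,$$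 $$\mathbb{D}_{abij}:=\int_0^{\pi/2}\Gamma_a\Gamma_be_ie_j\tan^2dx,\qquad \overline{\mathbb{D}}_{abij}:=\int_0^{\pi/2}\Gamma_a\Gamma_b\frac{e_i'}{\omega_i}\frac{e_j'}{\omega_j}\tan^2dx,$$ $$\mathbb{E}_{1423ij}:=\int_0^{\pi/2}(\Gamma_1\Gamma_4+\Gamma_2\Gamma_3)e_ie_j\tan^2dx,\qquad \overline{\mathbb{E}}_{1423ij}:=\int_0^{\pi/2}(\Gamma_1\Gamma_4+\Gamma_2\Gamma_3)\frac{e_i'}{\omega_i}\frac{e_j'}{\omega_j}\tan^2dx,$$ $$\mathbb{G}_{jki}:=\int_0^{\pi/2}e_ie_je_k\tan^2dx,\qquad \mathbb{F}_{ajki}:=\int_0^{\pi/2}\Gamma_ae_ie_je_k\tan^2dx,$$ $$\mathbb{J}_{jki}:=\int_0^{\pi/2}\frac{e_j'}{\omega_j}\frac{e_k'}{\omega_k}\frac{e_i'}{\omega_i}\frac{\sin^3}{\cos}dx,\qquad \mathbb{P}_{ajki}:=\int_0^{\pi/2}\Gamma_a\frac{e_j'}{\omega_j}\frac{e_k'}{\omega_k}\frac{e_i'}{\omega_i}\frac{\sin^3}{\cos}dx,$$ $$\overline{\mathbb{J}}_{jki}:=\int_0^{\pi/2}\frac{e_j'}{\omega_j}\frac{e_k'}{\omega_k}\left(\int_x^{\pi/2}e_i(y)\sin(y)\cos(y)dy\right)\tan^2(x)dx,$$ $$\overline{\mathbb{P}}_{ajki}:=\int_0^{\pi/2}\Gamma_a\frac{e_j'}{\omega_j}\frac{e_k'}{\omega_k}\left(\int_x^{\pi/2}e_i(y)\sin(y)\cos(y)dy\right)\tan^2(x)dx.$$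 An index $0$ (as in $\mathbb{G}_{0ji}$, $\mathbb{F}_{a0ji}$, $\mathbb{P}_{a0ji}$, $\mathbb{J}_{0ji}$) means that the corresponding index is set equal to $0$. Conventions. $\sum_\pm$ is the sum over the two choices $\omega_i+\omega_j$ and $\omega_i-\omega_j$. The estimates are understood along arbitrary sequences of pairs $(i,j)$ with both indices tending to $+\infty$; ''$\omega_i-\omega_j\to\infty$'' means that it tends to $+\infty$ along the sequence. $\sum_\pm\mathcal{O}(f_\pm)$ denotes a quantity bounded in absolute value, for all sufficiently large indices along the sequence, by a constant times $\sum_\pm|f_\pm|$. ''First non-vanishing derivative $F^{(n)}(\pi/2)\ne0$'' (here $n$ odd) means: $F^{(q)}(0)=F^{(q)}(\pi/2)=0$ for all odd $q<n$, and $F^{(n)}(\pi/2)\neq0$. Values at endpoints are understood by continuous extension. *)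

(* Defs.v *)
From Stdlib Require Import Reals Factorial.
From Coquelicot Require Import Coquelicot.
Open Scope R_scope.

(* Euler's Gamma function, for a positive argument z. *)
Definition EulerGamma (z : R) : R :=
  RInt_gen (fun t => Rpower t (z - 1) * exp (- t))
           (at_right 0) (Rbar_locally p_infty).

(* Generalized binomial coefficient: a (a-1) ... (a-k+1) / k!. *)
Fixpoint gbinom (a : R) (k : nat) : R :=
  match k with
  | O => 1
  | S m => gbinom a m * (a - INR m) / INR (S m)
  end.

(* Jacobi polynomial, by Szego's formula (4.3.2); P_n(1) = gbinom (n + alpha) n. *)
Definition jacobi (alpha beta : R) (n : nat) (x : R) : R :=
  sum_n (fun s => gbinom (INR n + alpha) (n - s) * gbinom (INR n + beta) s
                  * ((x - 1) / 2) ^ s * ((x + 1) / 2) ^ (n - s)) n.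

Definition omega (i : nat) : R := 3 + 2 * INR i.

Definition e (i : nat) (x : R) : R :=
  2 * (sqrt (INR (fact i) * INR (fact (i + 2))) / EulerGamma (INR i + 3 / 2))
  * cos x ^ 3 * jacobi (1 / 2) (3 / 2) i (cos (2 * x)).

Definition de (i : nat) (x : R) : R := Derive (e i) x.

(* At x = 0 the integrals vanish, so Gam1 0 = Gam2 0 = 0, which is also
   the continuous extension. *)
Definition Gam1 (x : R) : R :=
  cos x ^ 3 / sin x * RInt (fun y => de 0 y ^ 2 * tan y ^ 2) 0 x.
Definition Gam2 (x : R) : R :=
  omega 0 ^ 2 * (cos x ^ 3 / sin x) * RInt (fun y => e 0 y ^ 2 * tan y ^ 2) 0 x.
Definition Gam3 (x : R) : R :=
  RInt (fun y => de 0 y ^ 2 * sin y * cos y) 0 x.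
Definition Gam4 (x : R) : R :=
  omega 0 ^ 2 * RInt (fun y => e 0 y ^ 2 * sin y * cos y) 0 x.

Inductive gidx : Set := g1 | g2 | g3 | g4.

Definition Gam (a : gidx) : R -> R :=
  match a with g1 => Gam1 | g2 => Gam2 | g3 => Gam3 | g4 => Gam4 end.

(* Several integrands below are 0/0 at an endpoint of [0, PI/2];
   [RInt] depends only on the values in the open interval. *)

Definition fourC (a b : gidx) (i j : nat) : R :=
  RInt (fun x => (Gam a x - Gam b x) * e i x * e j x * tan x ^ 2) 0 (PI / 2).
Definition fourCbar (a b : gidx) (i j : nat) : R :=
  RInt (fun x => (Gam a x - Gam b x) * (de i x / omega i) * (de j x / omega j)
                 * tan x ^ 2) 0 (PI / 2).

Definition fourD (a b : gidx) (i j : nat) : R :=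
  RInt (fun x => Gam a x * Gam b x * e i x * e j x * tan x ^ 2) 0 (PI / 2).
Definition fourDbar (a b : gidx) (i j : nat) : R :=
  RInt (fun x => Gam a x * Gam b x * (de i x / omega i) * (de j x / omega j)
                 * tan x ^ 2) 0 (PI / 2).

Definition fourE1423 (i j : nat) : R :=
  RInt (fun x => (Gam g1 x * Gam g4 x + Gam g2 x * Gam g3 x)
                 * e i x * e j x * tan x ^ 2) 0 (PI / 2).
Definition fourE1423bar (i j : nat) : R :=
  RInt (fun x => (Gam g1 x * Gam g4 x + Gam g2 x * Gam g3 x)
                 * (de i x / omega i) * (de j x / omega j) * tan x ^ 2) 0 (PI / 2).

Definition fourG (j k i : nat) : R :=
  RInt (fun x => e i x * e j x * e k x * tan x ^ 2) 0 (PI / 2).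
Definition fourF (a : gidx) (j k i : nat) : R :=
  RInt (fun x => Gam a x * e i x * e j x * e k x * tan x ^ 2) 0 (PI / 2).

Definition fourJ (j k i : nat) : R :=
  RInt (fun x => de j x / omega j * (de k x / omega k) * (de i x / omega i)
                 * (sin x ^ 3 / cos x)) 0 (PI / 2).
Definition fourP (a : gidx) (j k i : nat) : R :=
  RInt (fun x => Gam a x * (de j x / omega j) * (de k x / omega k)
                 * (de i x / omega i) * (sin x ^ 3 / cos x)) 0 (PI / 2).

Definition fourJbar (j k i : nat) : R :=
  RInt (fun x => de j x / omega j * (de k x / omega k)
                 * RInt (fun y => e i y * sin y * cos y) x (PI / 2)
                 * tan x ^ 2) 0 (PI / 2).
Definition fourPbar (a : gidx) (j k i : nat) : R :=
  RInt (fun x => Gam a x * (de j x / omega j) * (de k x / omega k)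
                 * RInt (fun y => e i y * sin y * cos y) x (PI / 2)
                 * tan x ^ 2) 0 (PI / 2).

Definition bigO (f g : nat -> R) : Prop :=
  exists K : R, eventually (fun n => Rabs (f n) <= K * Rabs (g n)).

(* f = sum_pm O(g_pm). *)
Definition bigO_pm (f gplus gminus : nat -> R) : Prop :=
  exists K : R, eventually (fun n =>
    Rabs (f n) <= K * (Rabs (gplus n) + Rabs (gminus n))).

(* With h i = A (omega i), along every sequence of pairs with both indices
   tending to infinity: Z i j = O(h i) if omega_i - omega_j does not tend to
   +infinity, and Z i j = sum_pm O(h i / (omega_i +- omega_j)^p) if it does. *)
Definition growth_decay (A : R -> R) (p : nat) (Z : nat -> nat -> R) : Prop :=
  forall i j : nat -> nat,
    filterlim i eventually eventually ->
    filterlim j eventually eventually ->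
    (~ is_lim_seq (fun n => omega (i n) - omega (j n)) p_infty ->
     bigO (fun n => Z (i n) (j n)) (fun n => A (omega (i n))))
    /\
    (is_lim_seq (fun n => omega (i n) - omega (j n)) p_infty ->
     bigO_pm (fun n => Z (i n) (j n))
       (fun n => A (omega (i n)) / (omega (i n) + omega (j n)) ^ p)
       (fun n => A (omega (i n)) / (omega (i n) - omega (j n)) ^ p)).

Definition estimate_a (p : nat) (X : nat -> nat -> R) : Prop :=
  growth_decay (fun w => w) p (fun i j => omega i * X i j).

Definition estimate_b (p : nat) (Y : nat -> nat -> R) : Prop :=
  growth_decay (fun w => / w) p Y.

(* Endpoint values of derivatives are one-sided limits from inside
   (0, PI/2), so only the restriction of F to that interval matters. *)
Definition first_nonvanishing (n : nat) (F : R -> R) : Prop :=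
  (forall x, 0 < x < PI / 2 -> forall q, (q <= n)%nat -> ex_derive_n F q x)
  /\ (forall q, (q < n)%nat -> Nat.Odd q ->
        filterlim (Derive_n F q) (at_right 0) (locally 0)
        /\ filterlim (Derive_n F q) (at_left (PI / 2)) (locally 0))
  /\ (exists l : R, l <> 0 /\
        filterlim (Derive_n F n) (at_left (PI / 2)) (locally l)).

(* Main.v *)
Require Import Defs.
From Stdlib Require Import Reals Lra Lia Factorial Arith.
From Coquelicot Require Import Coquelicot.
Open Scope R_scope.

(** The eigenfunctions are trigonometric. The coefficients of the Jacobi polynomials
    with parameters [1/2, 3/2] are binomial coefficients of an even number, and de
    Moivre's formula gives on [(0, PI / 2)], with an amplitude [a_i] of order
    [1 / omega i],
    [tan x * e i x = a_i * (omega i * sin (omega i * x) - tan x * cos (omega i * x))],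
    [tan x * de i x / omega i = a_i * (omega i * cos (omega i * x) - sin (omega i * x) / tan x)].
    Hence every Fourier constant is a bounded combination of integrals of a fixed
    weight against a product of two waves, that is, against waves of the even
    frequencies [omega i - omega j] and [omega i + omega j].

    Such an integral is expanded by repeated integration by parts
    ([weight_expansion]). At [0] the weights have a parity, which kills all boundary
    terms; at [PI / 2] the terms vanish up to the order [n] at which the weight stops
    being symmetric about [PI / 2], and an integral of this kind is of order
    [1 / (omega i - omega j) ^ (n + 1)]. The order is read off from one identity
    between the weight and its reflection, the predicate [weight], which is stable
    under products and loses one order under differentiation. The same identity gives
    the first non-vanishing odd derivatives ([weight_derivatives]).

    The terms with a tangent have a factor [1 / omega i] or [1 / omega j] in excess and
    a weight with a zero less at [PI / 2]. A factor [1 / omega i] makes up for this,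
    the gap being smaller than [omega i]. A factor [1 / omega j] does not when [j] is
    much smaller than [i], but then the leading terms at the sum and at the difference
    of the frequencies have opposite signs and nearly cancel ([expansion_cancel]). The
    weights [Gam1 - Gam3] and [Gam2 - Gam4] are not zero at [PI / 2]; their values
    there contribute multiples of the scalar products of the eigenfunctions, which are
    orthogonal ([eigen_orthogonal]).

    It remains to know the weights. [Gam3] and [Gam4] are polynomials in the squared
    cosine. [Gam1] and [Gam2] contain the primitives of [cos ^ 2 * sin ^ 4] and
    [cos ^ 4 * sin ^ 2], which are powers of the sine times smooth even functions
    [Q1] and [Q2], and which at [PI - x] are [PI / 16] minus their value at [x]. Both
    have an odd power of the cosine in front, so this constant makes order three; in
    the products with [e 0] or [de 0 * sin * cos] the power is even, the constant is
    harmless, and the order is decided by the primitive taken from [PI / 2] instead,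
    which vanishes to third or fifth order there: orders nine and eleven. *)

(** * Smooth functions on an interval *)

Definition smooth (a b : R) (f : R -> R) : Prop :=
  forall n x, a < x < b -> ex_derive_n f n x.

Lemma locally_open_interval (a b x : R) (P : R -> Prop) :
  a < x < b -> (forall y, a < y < b -> P y) -> locally x P.
Proof.
  intros Hx HP.
  assert (Hd : 0 < Rmin (x - a) (b - x)) by (apply Rmin_glb_lt; lra).
  exists (mkposreal _ Hd). intros y Hy.
  apply HP. unfold ball in Hy; simpl in Hy; unfold AbsRing_ball, abs, minus, plus, opp in Hy.
  simpl in Hy. apply Rabs_def2 in Hy.
  pose proof (Rmin_l (x - a) (b - x)). pose proof (Rmin_r (x - a) (b - x)). lra.
Qed.

(** Smoothness by coinduction: a class of functions in which every member has its
    derivative consists of smooth functions. It reduces each closure property below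
    to a single differentiation. *)
Lemma smooth_coind (a b : R) (P : (R -> R) -> Prop) :
  (forall f, P f -> exists g, P g /\ forall x, a < x < b -> is_derive f x (g x)) ->
  forall f, P f -> smooth a b f.
Proof.
  intros HP f Hf.
  assert (Hn : forall n, exists g, P g /\ forall x, a < x < b -> Derive_n f n x = g x).
  { induction n as [|n [g [Pg Hg]]].
    - exists f. split; [exact Hf | reflexivity].
    - destruct (HP g Pg) as [g' [Pg' Hg']]. exists g'. split; [exact Pg'|].
      intros x Hx. simpl. transitivity (Derive g x).
      + apply Derive_ext_loc. now apply (locally_open_interval a b).
      + apply is_derive_unique. now apply Hg'. }
  intros [|n] x Hx; [exact I|]. simpl.
  destruct (Hn n) as [g [Pg Hg]]. destruct (HP g Pg) as [g' [_ Hg']].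
  exists (g' x). apply is_derive_ext_loc with g.
  - apply (locally_open_interval a b); [exact Hx|]. intros y Hy. symmetry. now apply Hg.
  - now apply Hg'.
Qed.

Lemma smooth_ex_derive (a b : R) (f : R -> R) (x : R) :
  smooth a b f -> a < x < b -> ex_derive f x.
Proof. intros Hf Hx. exact (Hf 1%nat x Hx). Qed.

Lemma smooth_is_derive (a b : R) (f : R -> R) (x : R) :
  smooth a b f -> a < x < b -> is_derive f x (Derive f x).
Proof. intros Hf Hx. apply Derive_correct. now apply (smooth_ex_derive a b). Qed.

Lemma smooth_continuous (a b : R) (f : R -> R) (x : R) :
  smooth a b f -> a < x < b -> continuous f x.
Proof.
  intros Hf Hx. apply (ex_derive_continuous (V := R_NormedModule)).
  now apply (smooth_ex_derive a b).
Qed.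

Lemma smooth_Derive (a b : R) (f : R -> R) : smooth a b f -> smooth a b (Derive f).
Proof.
  intros Hf [|n] x Hx; [exact I|]. simpl.
  apply ex_derive_ext with (Derive_n f (S n)).
  - intros t. change (Derive f) with (Derive_n f 1).
    rewrite Derive_n_comp. now rewrite Nat.add_1_r.
  - exact (Hf (S (S n)) x Hx).
Qed.

Lemma smooth_ext (a b : R) (f g : R -> R) :
  (forall x, a < x < b -> f x = g x) -> smooth a b f -> smooth a b g.
Proof.
  intros Hfg Hf n x Hx. apply ex_derive_n_ext_loc with f; [|now apply Hf].
  now apply (locally_open_interval a b).
Qed.

Lemma smooth_sub (a b a' b' : R) (f : R -> R) :
  a <= a' -> b' <= b -> smooth a b f -> smooth a' b' f.
Proof. intros Ha Hb Hf n x Hx. apply Hf. lra. Qed.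

(** Sums, products and inverses of smooth functions, taken together: this
    class is closed under differentiation, which no single operation is. *)
Inductive smooth_alg (a b : R) : (R -> R) -> Prop :=
| alg_base f : smooth a b f -> smooth_alg a b f
| alg_plus f g : smooth_alg a b f -> smooth_alg a b g ->
    smooth_alg a b (fun x => f x + g x)
| alg_mult f g : smooth_alg a b f -> smooth_alg a b g ->
    smooth_alg a b (fun x => f x * g x)
| alg_inv f : smooth_alg a b f -> (forall x, a < x < b -> f x <> 0) ->
    smooth_alg a b (fun x => / f x).

Lemma smooth_const (a b c : R) : smooth a b (fun _ => c).
Proof.
  apply (smooth_coind a b (fun f => exists d, f = fun _ => d)); [|now exists c].
  intros f [d ->]. exists (fun _ => 0). split; [now exists 0|].
  intros x _. apply (is_derive_const (K := R_AbsRing) (V := R_NormedModule)).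
Qed.

Lemma smooth_alg_smooth (a b : R) (f : R -> R) : smooth_alg a b f -> smooth a b f.
Proof.
  apply smooth_coind. clear f. intros f Hf.
  induction Hf as [f Hf|f g Hf [f' [Af Df]] Hg [g' [Ag Dg]]
                  |f g Hf [f' [Af Df]] Hg [g' [Ag Dg]]|f Hf [f' [Af Df]] Hnz].
  - exists (Derive f). split; [apply alg_base; now apply smooth_Derive|].
    intros x Hx. now apply (smooth_is_derive a b).
  - exists (fun x => f' x + g' x). split; [now apply alg_plus|].
    intros x Hx. apply (is_derive_plus (K := R_AbsRing) (V := R_NormedModule)); auto.
  - exists (fun x => f' x * g x + f x * g' x).
    split; [apply alg_plus; now apply alg_mult|].
    intros x Hx. apply (is_derive_mult (K := R_AbsRing)); auto.
    intros; apply Rmult_comm.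
  - exists (fun x => (-1) * (f' x * (/ f x * / f x))). split.
    + apply alg_mult; [apply alg_base, smooth_const|].
      apply alg_mult; [assumption|]. apply alg_mult; now apply alg_inv.
    + intros x Hx. specialize (Hnz x Hx).
      replace (-1 * (f' x * (/ f x * / f x))) with (- f' x / f x ^ 2) by now field.
      apply is_derive_inv; auto.
Qed.

Lemma smooth_plus (a b : R) (f g : R -> R) :
  smooth a b f -> smooth a b g -> smooth a b (fun x => f x + g x).
Proof. intros; apply smooth_alg_smooth, alg_plus; now apply alg_base. Qed.

Lemma smooth_mult (a b : R) (f g : R -> R) :
  smooth a b f -> smooth a b g -> smooth a b (fun x => f x * g x).
Proof. intros; apply smooth_alg_smooth, alg_mult; now apply alg_base. Qed.

Lemma smooth_inv (a b : R) (f : R -> R) :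
  smooth a b f -> (forall x, a < x < b -> f x <> 0) -> smooth a b (fun x => / f x).
Proof. intros; apply smooth_alg_smooth, alg_inv; [now apply alg_base|assumption]. Qed.

Lemma smooth_opp (a b : R) (f : R -> R) : smooth a b f -> smooth a b (fun x => - f x).
Proof.
  intros Hf. apply smooth_ext with (fun x => (-1) * f x); [intros; ring|].
  apply smooth_mult; [apply smooth_const|assumption].
Qed.

Lemma smooth_minus (a b : R) (f g : R -> R) :
  smooth a b f -> smooth a b g -> smooth a b (fun x => f x - g x).
Proof. intros; apply smooth_plus; [assumption|now apply smooth_opp]. Qed.

Lemma smooth_div (a b : R) (f g : R -> R) :
  smooth a b f -> smooth a b g -> (forall x, a < x < b -> g x <> 0) ->
  smooth a b (fun x => f x / g x).
Proof. intros; apply smooth_mult; [assumption|now apply smooth_inv]. Qed.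

Lemma smooth_pow (a b : R) (f : R -> R) (n : nat) :
  smooth a b f -> smooth a b (fun x => f x ^ n).
Proof.
  intros Hf. induction n as [|n IH]; simpl; [apply smooth_const|].
  now apply smooth_mult.
Qed.

Lemma smooth_id (a b : R) : smooth a b (fun x => x).
Proof.
  apply (smooth_coind a b (fun f => f = (fun x => x) \/ exists d, f = fun _ => d)); [|now left].
  intros f [->|[d ->]].
  - exists (fun _ => 1). split; [right; now exists 1|].
    intros x _. apply (is_derive_id (K := R_AbsRing)).
  - exists (fun _ => 0). split; [right; now exists 0|].
    intros x _. apply (is_derive_const (K := R_AbsRing) (V := R_NormedModule)).
Qed.

Lemma smooth_trig (a b c d w : R) :
  smooth a b (fun x => c * sin (w * x) + d * cos (w * x)).
Proof.
  apply (smooth_coind a b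
    (fun f => exists c d, f = fun x => c * sin (w * x) + d * cos (w * x)));
    [|now exists c, d].
  clear c d. intros f [c [d ->]].
  exists (fun x => (- d * w) * sin (w * x) + (c * w) * cos (w * x)).
  split; [now exists (- d * w), (c * w)|].
  intros x _. auto_derive; [exact I|ring].
Qed.

Lemma smooth_sin_lin (a b w : R) : smooth a b (fun x => sin (w * x)).
Proof.
  apply smooth_ext with (fun x => 1 * sin (w * x) + 0 * cos (w * x)); [intros; ring|].
  apply smooth_trig.
Qed.

Lemma smooth_cos_lin (a b w : R) : smooth a b (fun x => cos (w * x)).
Proof.
  apply smooth_ext with (fun x => 0 * sin (w * x) + 1 * cos (w * x)); [intros; ring|].
  apply smooth_trig.
Qed.

Lemma smooth_sin (a b : R) : smooth a b (fun x => sin x).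
Proof.
  apply smooth_ext with (fun x => sin (1 * x)); [intros; now rewrite Rmult_1_l|].
  apply smooth_sin_lin.
Qed.

Lemma smooth_cos (a b : R) : smooth a b (fun x => cos x).
Proof.
  apply smooth_ext with (fun x => cos (1 * x)); [intros; now rewrite Rmult_1_l|].
  apply smooth_cos_lin.
Qed.

Lemma smooth_reflect (a b c : R) (f : R -> R) :
  smooth a b f -> smooth (c - b) (c - a) (fun x => f (c - x)).
Proof.
  intros Hf.
  apply smooth_ext with (fun x => 1 * f (c - x)); [intros; ring|].
  apply (smooth_coind (c - b) (c - a) (fun h => exists g d, smooth a b g /\
          h = fun x => d * g (c - x))); [|now exists f, 1].
  clear f Hf. intros h [g [d [Hg ->]]].
  exists (fun x => (- d) * Derive g (c - x)). split.
  - exists (Derive g), (- d). split; [now apply smooth_Derive|reflexivity].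
  - intros x Hx. auto_derive.
    + apply (smooth_ex_derive a b); [exact Hg|lra].
    + change (fun x => g x) with g. replace (c + - x) with (c - x) by ring. ring.
Qed.

(** The averages of a function along the segment from [0] to [x]. Differentiating
    under the integral sign only raises the weight and differentiates the
    function, so they are smooth. They turn a zero at the origin into an explicit
    factor: integrating [y^k * f y] from [0] to [x] gives [x^(k+1) * dilation k f x]. *)
Definition dilation (k : nat) (f : R -> R) (x : R) : R :=
  RInt (fun t => t ^ k * f (x * t)) 0 1.

Lemma dilation_arg (b x t : R) :
  - b < x < b -> 0 <= t <= 1 -> - b < x * t < b.
Proof. intros Hx Ht. nra. Qed.

Lemma dilation_ex_RInt (b : R) (k : nat) (f : R -> R) (x : R) :
  smooth (- b) b f -> - b < x < b -> ex_RInt (fun t => t ^ k * f (x * t)) 0 1.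
Proof.
  intros Hf Hx. apply (ex_RInt_continuous (V := R_CompleteNormedModule)).
  rewrite Rmin_left, Rmax_right by lra. intros t Ht.
  apply (ex_derive_continuous (V := R_NormedModule)). auto_derive.
  repeat split. apply (smooth_ex_derive (- b) b); [exact Hf|].
  now apply dilation_arg.
Qed.

Lemma is_derive_dilation (b : R) (k : nat) (f : R -> R) (x : R) :
  smooth (- b) b f -> - b < x < b ->
  is_derive (dilation k f) x (dilation (S k) (Derive f) x).
Proof.
  intros Hf Hx.
  assert (HD : forall u t, - b < u * t < b ->
    is_derive (fun u => t ^ k * f (u * t)) u (t ^ S k * Derive f (u * t))).
  { intros u t Hut. auto_derive.
    - repeat split. now apply (smooth_ex_derive (- b) b).
    - change (fun x => f x) with f. simpl. ring. }
  replace (dilation (S k) (Derive f) x) with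
    (RInt (fun t => Derive (fun u => t ^ k * f (u * t)) x) 0 1).
  - apply (is_derive_RInt_param (fun u t => t ^ k * f (u * t)) 0 1 x);
      rewrite ?Rmin_left, ?Rmax_right by lra.
    + apply (locally_open_interval (- b) b); [exact Hx|].
      intros u Hu t Ht. eexists. apply HD. now apply dilation_arg.
    + intros t Ht. pose proof (dilation_arg b x t Hx Ht) as Hxt.
      assert (Hc : continuity_2d_pt (fun u v => u * v) x t).
      { apply continuity_2d_pt_mult;
          [apply continuity_2d_pt_id1|apply continuity_2d_pt_id2]. }
      apply continuity_2d_pt_ext_loc with (fun u v => v ^ S k * Derive f (u * v)).
      * assert (He : 0 < Rmin (x * t + b) (b - x * t)) by (apply Rmin_glb_lt; lra).
        destruct (Hc (mkposreal _ He)) as [d Hd]. exists d. intros u v Hu Hv.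
        symmetry. apply is_derive_unique, HD.
        specialize (Hd u v Hu Hv). simpl in Hd. apply Rabs_def2 in Hd.
        pose proof (Rmin_l (x * t + b) (b - x * t)).
        pose proof (Rmin_r (x * t + b) (b - x * t)). lra.
      * apply continuity_2d_pt_mult.
        -- apply (continuity_1d_2d_pt_comp (fun v => v ^ S k) (fun u v => v) x t);
             [|apply continuity_2d_pt_id2].
           apply derivable_continuous_pt, derivable_pt_pow.
        -- apply (continuity_1d_2d_pt_comp (Derive f) (fun u v => u * v) x t);
             [|exact Hc].
           apply continuity_pt_filterlim. apply (smooth_continuous (- b) b); [|exact Hxt].
           now apply smooth_Derive.
    + apply (locally_open_interval (- b) b); [exact Hx|].
      intros u Hu. now apply dilation_ex_RInt with b.
  - unfold dilation. apply RInt_ext. rewrite Rmin_left, Rmax_right by lra.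
    intros t Ht. apply is_derive_unique. apply HD. apply dilation_arg; [exact Hx|lra].
Qed.

Lemma smooth_dilation (b : R) (k : nat) (f : R -> R) :
  smooth (- b) b f -> smooth (- b) b (dilation k f).
Proof.
  intros Hf.
  apply (smooth_coind (- b) b (fun h => exists k g, smooth (- b) b g /\ h = dilation k g));
    [|now exists k, f].
  clear k f Hf. intros h [k [g [Hg ->]]].
  exists (dilation (S k) (Derive g)). split.
  - exists (S k), (Derive g). split; [now apply smooth_Derive|reflexivity].
  - intros x Hx. now apply is_derive_dilation with b.
Qed.

Lemma RInt_dilation (b : R) (k : nat) (f : R -> R) (x : R) :
  smooth (- b) b f -> - b < x < b ->
  RInt (fun y => y ^ k * f y) 0 x = x ^ S k * dilation k f x.
Proof.
  intros Hf Hx.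
  assert (He : ex_RInt (fun y => y ^ k * f y) (x * 0 + 0) (x * 1 + 0)).
  { apply (ex_RInt_continuous (V := R_CompleteNormedModule)). intros y Hy.
    apply (smooth_continuous (- b) b).
    - apply smooth_mult; [apply smooth_pow, smooth_id|assumption].
    - revert Hy. unfold Rmin, Rmax. destruct Rle_dec; intros; nra. }
  pose proof (RInt_comp_lin _ _ _ _ _ He) as E.
  replace (x * 0 + 0) with 0 in E by ring. replace (x * 1 + 0) with x in E by ring.
  rewrite <- E. unfold dilation.
  transitivity (RInt (fun t => scal (x ^ S k) (t ^ k * f (x * t))) 0 1).
  - apply RInt_ext. intros t _. unfold scal; simpl; unfold mult; simpl.
    rewrite Rplus_0_r, Rpow_mult_distr. ring.
  - apply (RInt_scal (V := R_CompleteNormedModule) (fun t => t ^ k * f (x * t))).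
    now apply dilation_ex_RInt with b.
Qed.

Lemma dilation_even (k : nat) (f : R -> R) (x : R) :
  (forall t, 0 < t < 1 -> f (- (x * t)) = f (x * t)) -> dilation k f (- x) = dilation k f x.
Proof.
  intros Hf. apply RInt_ext. rewrite Rmin_left, Rmax_right by lra. intros t Ht.
  replace (- x * t) with (- (x * t)) by ring. now rewrite Hf.
Qed.

Lemma dilation_gt_0 (b : R) (k : nat) (f : R -> R) (x : R) :
  smooth (- b) b f -> - b < x < b -> (forall t, 0 < t < 1 -> 0 < f (x * t)) ->
  0 < dilation k f x.
Proof.
  intros Hf Hx Hpos. apply RInt_gt_0; [lra| |].
  - intros t Ht. apply Rmult_lt_0_compat; [now apply pow_lt|now apply Hpos].
  - intros t Ht. apply (ex_derive_continuous (V := R_NormedModule)). auto_derive.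
    repeat split. apply (smooth_ex_derive (- b) b); [exact Hf|].
    now apply dilation_arg.
Qed.

(** * Weights with prescribed reflections *)

(** [n] is the order at which [W] stops being [tau]-symmetric about [PI / 2], and
    [H] is the discrepancy there. For [tau = 1] and odd [n] it makes the odd
    derivatives of [W] below the [n]-th vanish at [PI / 2] and the [n]-th a nonzero
    multiple of [H (PI / 2)]; unlike conditions on the derivatives, it can be read off
    a product. *)
Definition weight (sg tau : R) (n : nat) (W H : R -> R) : Prop :=
  smooth (- PI) PI W /\ smooth 0 PI H /\
  (forall x, - PI < x < PI -> W (- x) = sg * W x) /\
  (forall x, 0 < x < PI -> W (PI - x) = tau * W x + cos x ^ n * H x).

Lemma weight_smooth sg tau n W H : weight sg tau n W H -> smooth (- PI) PI W.
Proof. now intros [HW _]. Qed.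

Lemma weight_mul (s t : R) (phi : R -> R) sg tau n W H :
  smooth (- PI) PI phi -> (forall x, phi (- x) = s * phi x) ->
  (forall x, phi (PI - x) = t * phi x) -> weight sg tau n W H ->
  weight (s * sg) (t * tau) n (fun x => phi x * W x) (fun x => t * phi x * H x).
Proof.
  intros Hphi P0 P1 (HW & HH & H0 & H1). pose proof PI_RGT_0.
  split; [|split; [|split]].
  - now apply smooth_mult.
  - apply smooth_mult; [apply smooth_mult; [apply smooth_const|]|exact HH].
    apply smooth_sub with (- PI) PI; [lra|lra|exact Hphi].
  - intros x Hx. rewrite P0, H0 by assumption. ring.
  - intros x Hx. rewrite P1, H1 by assumption. ring.
Qed.

Lemma cos_PI_minus (x : R) : cos (PI - x) = - cos x.
Proof. rewrite cos_minus, cos_PI, sin_PI. ring. Qed.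

Lemma weight_mul_scal c sg tau n W H :
  weight sg tau n W H -> weight sg tau n (fun x => c * W x) (fun x => c * H x).
Proof.
  intros HW. rewrite <- (Rmult_1_l sg), <- (Rmult_1_l tau).
  destruct (weight_mul 1 1 (fun _ => c) sg tau n W H) as (A & B & C & D);
    try (intros; ring); try assumption; [apply smooth_const|].
  split; [exact A|split; [|split; [exact C|]]].
  - apply smooth_ext with (2 := B). intros; ring.
  - intros x Hx. rewrite D by exact Hx. ring.
Qed.

Lemma weight_mul_sin sg tau n W H :
  weight sg tau n W H ->
  weight (- sg) tau n (fun x => sin x * W x) (fun x => sin x * H x).
Proof.
  intros HW. replace (- sg) with ((-1) * sg) by ring. rewrite <- (Rmult_1_l tau).
  destruct (weight_mul (-1) 1 sin sg tau n W H) as (A & B & C & D); try assumption.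
  - apply smooth_sin.
  - intros x. rewrite sin_neg. ring.
  - intros x. rewrite sin_PI_x. ring.
  - split; [exact A|split; [|split; [exact C|]]].
    + apply smooth_ext with (2 := B). intros; ring.
    + intros x Hx. rewrite D by exact Hx. ring.
Qed.

Lemma weight_mul_cos sg tau n W H :
  weight sg tau n W H ->
  weight sg (- tau) (S n) (fun x => cos x * W x) (fun x => - H x).
Proof.
  intros (HW & HH & H0 & H1). split; [|split; [|split]].
  - apply smooth_mult; [apply smooth_cos|exact HW].
  - now apply smooth_opp.
  - intros x Hx. rewrite cos_neg, H0 by exact Hx. ring.
  - intros x Hx. rewrite cos_PI_minus, H1 by exact Hx. simpl. ring.
Qed.

Lemma Derive_parity (sg : R) (W : R -> R) :
  smooth (- PI) PI W -> (forall x, - PI < x < PI -> W (- x) = sg * W x) ->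
  forall x, - PI < x < PI -> Derive W (- x) = - sg * Derive W x.
Proof.
  intros HW H0 x Hx.
  assert (E : - Derive W (- x) = sg * Derive W x).
  { rewrite <- Derive_scal.
    transitivity (Derive (fun y => W (- y)) x).
    - symmetry. apply is_derive_unique. auto_derive.
      + apply (smooth_ex_derive (- PI) PI); [exact HW|lra].
      + change (fun x => W x) with W. ring.
    - apply Derive_ext_loc. apply (locally_open_interval (- PI) PI); [exact Hx|].
      intros y Hy. now apply H0. }
  lra.
Qed.

(** Differentiating lowers the order by one and leaves a multiple of [H] as the
    discrepancy at [PI / 2], where the cosine vanishes. *)
Lemma weight_derive sg tau n W H :
  weight sg tau (S n) W H ->
  weight (- sg) (- tau) n (Derive W)
    (fun x => INR (S n) * sin x * H x - cos x * Derive H x).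
Proof.
  intros (HW & HH & H0 & H1). split; [|split; [|split]].
  - now apply smooth_Derive.
  - apply smooth_minus.
    + apply smooth_mult; [|exact HH]. apply smooth_mult; [apply smooth_const|apply smooth_sin].
    + apply smooth_mult; [apply smooth_cos|now apply smooth_Derive].
  - intros x Hx.
    now apply Derive_parity.
  - intros x Hx.
    assert (E : - Derive W (PI - x) =
      tau * Derive W x + cos x ^ n * (cos x * Derive H x - INR (S n) * sin x * H x)).
    { transitivity (Derive (fun y => W (PI - y)) x).
      - symmetry. apply is_derive_unique. auto_derive.
        + apply (smooth_ex_derive (- PI) PI); [exact HW|lra].
        + change (fun x => W x) with W. replace (PI + - x) with (PI - x) by ring. ring.
      - transitivity (Derive (fun y => tau * W y + cos y ^ S n * H y) x).
        + apply Derive_ext_loc. apply (locally_open_interval 0 PI); [exact Hx|].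
          intros y Hy. now apply H1.
        + apply is_derive_unique. auto_derive.
          * split; [apply (smooth_ex_derive (- PI) PI); [exact HW|lra]|].
            split; [|exact I]. now apply (smooth_ex_derive 0 PI).
          * change (fun x => W x) with W. change (fun x => H x) with H.
            rewrite S_INR. destruct n; simpl; ring. }
    lra.
Qed.

(** * Oscillatory integrals *)

Definition quarter (f : R -> R) : R := RInt f 0 (PI / 2).

Lemma smooth_ex_RInt (f : R -> R) : smooth (- PI) PI f -> ex_RInt f 0 (PI / 2).
Proof.
  intros Hf. pose proof PI_RGT_0. apply (ex_RInt_continuous (V := R_CompleteNormedModule)).
  rewrite Rmin_left, Rmax_right by lra. intros x Hx.
  apply (smooth_continuous (- PI) PI); [exact Hf|lra].
Qed.

Lemma quarter_ext (f g : R -> R) :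
  (forall x, 0 < x < PI / 2 -> f x = g x) -> quarter f = quarter g.
Proof.
  intros E. pose proof PI_RGT_0. apply RInt_ext.
  rewrite Rmin_left, Rmax_right by lra. exact E.
Qed.

Lemma quarter_plus (f g : R -> R) :
  smooth (- PI) PI f -> smooth (- PI) PI g ->
  quarter (fun x => f x + g x) = quarter f + quarter g.
Proof.
  intros Hf Hg.
  apply (RInt_plus (V := R_CompleteNormedModule)); now apply smooth_ex_RInt.
Qed.

Lemma quarter_scal (c : R) (f : R -> R) :
  smooth (- PI) PI f -> quarter (fun x => c * f x) = c * quarter f.
Proof.
  intros Hf. apply (RInt_scal (V := R_CompleteNormedModule)). now apply smooth_ex_RInt.
Qed.

Lemma quarter_derive (f : R -> R) :
  smooth (- PI) PI f -> quarter (Derive f) = f (PI / 2) - f 0.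
Proof.
  intros Hf. pose proof PI_RGT_0. apply is_RInt_unique.
  apply (is_RInt_derive (V := R_CompleteNormedModule));
    rewrite Rmin_left, Rmax_right by lra; intros x Hx.
  - apply (smooth_is_derive (- PI) PI); [exact Hf|lra].
  - apply (smooth_continuous (- PI) PI); [now apply smooth_Derive|lra].
Qed.

Lemma smooth_bounded (f : R -> R) :
  smooth (- PI) PI f -> exists K, 0 <= K /\ forall x, 0 <= x <= PI / 2 -> Rabs (f x) <= K.
Proof.
  intros Hf. pose proof PI_RGT_0.
  destruct (continuity_ab_maj (fun x => Rabs (f x)) 0 (PI / 2)) as [m [Hm _]]; [lra| |].
  - intros x Hx. apply (continuity_pt_comp f Rabs); [|apply Rcontinuity_abs].
    apply continuity_pt_filterlim, (smooth_continuous (- PI) PI); [exact Hf|lra].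
  - exists (Rabs (f m)). split; [apply Rabs_pos|exact Hm].
Qed.

Lemma quarter_bound (f : R -> R) (K : R) :
  smooth (- PI) PI f -> (forall x, 0 <= x <= PI / 2 -> Rabs (f x) <= K) ->
  Rabs (quarter f) <= 2 * K.
Proof.
  intros Hf HK. pose proof PI_RGT_0. pose proof PI_4.
  apply Rle_trans with ((PI / 2 - 0) * K).
  - apply abs_RInt_le_const; [lra|now apply smooth_ex_RInt|exact HK].
  - assert (0 <= K).
    { apply Rle_trans with (Rabs (f 0)); [apply Rabs_pos|apply HK; lra]. }
    apply Rmult_le_compat_r; lra.
Qed.

Definition wave (b : bool) (t : R) : R := if b then cos t else sin t.

Lemma wave_le_1 (b : bool) (t : R) : Rabs (wave b t) <= 1.
Proof.
  apply Rabs_le. destruct b; simpl; [apply COS_bound|apply SIN_bound].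
Qed.

Lemma smooth_wave (a b w : R) (s : bool) : smooth a b (fun x => wave s (w * x)).
Proof. destruct s; [apply smooth_cos_lin|apply smooth_sin_lin]. Qed.

Lemma quarter_wave_bound (f : R -> R) :
  smooth (- PI) PI f ->
  exists K, 0 <= K /\ forall b w, Rabs (quarter (fun x => f x * wave b (w * x))) <= K.
Proof.
  intros Hf. destruct (smooth_bounded f Hf) as [K [HK0 HK]].
  exists (2 * K). split; [lra|]. intros b w. apply quarter_bound.
  - apply smooth_mult; [exact Hf|apply smooth_wave].
  - intros x Hx. rewrite Rabs_mult. rewrite <- (Rmult_1_r K).
    apply Rmult_le_compat; [apply Rabs_pos|apply Rabs_pos|now apply HK|apply wave_le_1].
Qed.

Lemma sin_mPI (m : nat) : sin (INR m * PI) = 0.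
Proof. apply sin_eq_0_1. exists (Z.of_nat m). now rewrite <- INR_IZR_INZ. Qed.

Lemma cos_mPI (m : nat) : cos (INR m * PI) = (-1) ^ m.
Proof.
  induction m as [|m IH]; [simpl; rewrite Rmult_0_l; apply cos_0|].
  rewrite S_INR, Rmult_plus_distr_r, Rmult_1_l, neg_cos, IH. simpl. ring.
Qed.

Lemma by_parts_cos (f : R -> R) (m : nat) :
  smooth (- PI) PI f -> (1 <= m)%nat ->
  quarter (fun x => f x * wave true (2 * INR m * x)) =
  - (quarter (fun x => Derive f x * wave false (2 * INR m * x)) / (2 * INR m)).
Proof.
  intros Hf Hm. assert (0 < INR m) by (apply lt_0_INR; lia).
  assert (Hs : smooth (- PI) PI (fun x => f x * sin (2 * INR m * x)))
    by (apply smooth_mult; [exact Hf|apply smooth_sin_lin]).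
  pose proof (quarter_derive _ Hs) as E. cbv beta in E.
  replace (2 * INR m * (PI / 2)) with (INR m * PI) in E by field.
  rewrite sin_mPI, !Rmult_0_r, sin_0 in E.
  rewrite (quarter_ext _ (fun x => Derive f x * wave false (2 * INR m * x)
             + 2 * INR m * (f x * wave true (2 * INR m * x)))) in E.
  - rewrite quarter_plus, quarter_scal in E.
    + apply (Rmult_eq_reg_l (2 * INR m)); [|lra]. field_simplify; lra.
    + apply smooth_mult; [exact Hf|apply smooth_wave].
    + apply smooth_mult; [now apply smooth_Derive|apply smooth_wave].
    + apply smooth_mult; [apply smooth_const|].
      apply smooth_mult; [exact Hf|apply smooth_wave].
  - intros x Hx. apply is_derive_unique. auto_derive.
    + apply (smooth_ex_derive (- PI) PI); [exact Hf|lra].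
    + change (fun x => f x) with f. simpl. ring.
Qed.

Lemma by_parts_sin (f : R -> R) (m : nat) :
  smooth (- PI) PI f -> (1 <= m)%nat ->
  quarter (fun x => f x * wave false (2 * INR m * x)) =
  (f 0 - f (PI / 2) * (-1) ^ m
   + quarter (fun x => Derive f x * wave true (2 * INR m * x))) / (2 * INR m).
Proof.
  intros Hf Hm. assert (0 < INR m) by (apply lt_0_INR; lia).
  assert (Hs : smooth (- PI) PI (fun x => f x * cos (2 * INR m * x)))
    by (apply smooth_mult; [exact Hf|apply smooth_cos_lin]).
  pose proof (quarter_derive _ Hs) as E. cbv beta in E.
  replace (2 * INR m * (PI / 2)) with (INR m * PI) in E by field.
  rewrite cos_mPI, Rmult_0_r, cos_0 in E.
  rewrite (quarter_ext _ (fun x => Derive f x * wave true (2 * INR m * x)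
             + (- (2 * INR m)) * (f x * wave false (2 * INR m * x)))) in E.
  - rewrite quarter_plus, quarter_scal in E.
    + apply (Rmult_eq_reg_l (2 * INR m)); [|lra]. field_simplify; lra.
    + apply smooth_mult; [exact Hf|apply smooth_wave].
    + apply smooth_mult; [now apply smooth_Derive|apply smooth_wave].
    + apply smooth_mult; [apply smooth_const|].
      apply smooth_mult; [exact Hf|apply smooth_wave].
  - intros x Hx. apply is_derive_unique. auto_derive.
    + apply (smooth_ex_derive (- PI) PI); [exact Hf|lra].
    + change (fun x => f x) with f. simpl. ring.
Qed.

(** [I m] is given, with frequency [2 m], by its first boundary term at [PI / 2]
    up to one more power of the frequency. *)
Definition expansion (n : nat) (I : nat -> R) : Prop :=
  exists c K, 0 <= K /\ forall m, (1 <= m)%nat ->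
    Rabs (I m - c * (-1) ^ m / (2 * INR m) ^ S n) <= K / (2 * INR m) ^ S (S n).

Lemma div_shift (a b : R) (n : nat) : 0 < b -> a / b ^ n / b = a / b ^ S n.
Proof. intros Hb. simpl. field. split; [apply pow_nonzero; lra|lra]. Qed.

Lemma expansion_shift n I J :
  (forall m, (1 <= m)%nat -> J m = I m / (2 * INR m)) ->
  expansion n I -> expansion (S n) J.
Proof.
  intros E (c & K & HK & HI). exists c, K. split; [exact HK|]. intros m Hm.
  assert (0 < INR m) by (apply lt_0_INR; lia).
  rewrite (E m Hm), <- (div_shift K _ (S (S n))), <- (div_shift _ _ (S n)) by lra.
  replace (I m / (2 * INR m) - c * (-1) ^ m / (2 * INR m) ^ S n / (2 * INR m))
    with ((I m - c * (-1) ^ m / (2 * INR m) ^ S n) / (2 * INR m))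
    by (unfold Rdiv; ring).
  unfold Rdiv at 1. rewrite Rabs_mult, (Rabs_pos_eq (/ _)).
  - apply Rmult_le_compat_r; [|now apply HI].
    left; apply Rinv_0_lt_compat; lra.
  - left; apply Rinv_0_lt_compat; lra.
Qed.

Lemma expansion_opp n I : expansion n I -> expansion n (fun m => - I m).
Proof.
  intros (c & K & HK & HI). exists (- c), K. split; [exact HK|]. intros m Hm.
  replace (- I m - - c * (-1) ^ m / (2 * INR m) ^ S n)
    with (- (I m - c * (-1) ^ m / (2 * INR m) ^ S n)) by (unfold Rdiv; ring).
  rewrite Rabs_Ropp. now apply HI.
Qed.

(** Without any symmetry the boundary terms still give one power of the frequency
    against a sine and, the sine vanishing at both ends, two against a cosine. *)
Lemma sin_integral_decay (f : R -> R) :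
  smooth (- PI) PI f ->
  exists K, 0 <= K /\ forall m, (1 <= m)%nat ->
    Rabs (quarter (fun x => f x * wave false (2 * INR m * x))) <= K / (2 * INR m).
Proof.
  intros Hf. destruct (quarter_wave_bound (Derive f)) as [K [HK0 HK]];
    [now apply smooth_Derive|].
  exists (Rabs (f 0) + Rabs (f (PI / 2)) + K).
  pose proof (Rabs_pos (f 0)). pose proof (Rabs_pos (f (PI / 2))). split; [lra|].
  intros m Hm. assert (0 < INR m) by (apply lt_0_INR; lia).
  rewrite (by_parts_sin f m Hf Hm). unfold Rdiv at 1.
  rewrite Rabs_mult, (Rabs_pos_eq (/ _)) by (left; apply Rinv_0_lt_compat; lra).
  apply Rmult_le_compat_r; [left; apply Rinv_0_lt_compat; lra|].
  eapply Rle_trans; [apply Rabs_triang|]. apply Rplus_le_compat; [|apply HK].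
  unfold Rminus. eapply Rle_trans; [apply Rabs_triang|].
  rewrite Rabs_Ropp, Rabs_mult, pow_1_abs. lra.
Qed.

Lemma cos_integral_decay (f : R -> R) :
  smooth (- PI) PI f ->
  exists K, 0 <= K /\ forall m, (1 <= m)%nat ->
    Rabs (quarter (fun x => f x * wave true (2 * INR m * x))) <= K / (2 * INR m) ^ 2.
Proof.
  intros Hf. destruct (sin_integral_decay (Derive f)) as [K [HK0 HK]];
    [now apply smooth_Derive|].
  exists K. split; [exact HK0|].
  intros m Hm. assert (0 < INR m) by (apply lt_0_INR; lia).
  rewrite (by_parts_cos f m Hf Hm), Rabs_Ropp. unfold Rdiv at 1.
  rewrite Rabs_mult, (Rabs_pos_eq (/ _)) by (left; apply Rinv_0_lt_compat; lra).
  replace (K / (2 * INR m) ^ 2) with (K / (2 * INR m) * / (2 * INR m)) by (field; lra).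
  apply Rmult_le_compat_r; [left; apply Rinv_0_lt_compat; lra|now apply HK].
Qed.

Definition parity (b : bool) : R := if b then 1 else -1.

(** Each integration by parts differentiates the weight, which turns the cosine
    case into the sine case and back and lowers the order by one. The boundary
    terms drop out: the sine vanishes at both ends, and an odd weight that is also
    anti-symmetric about [PI / 2] vanishes at both ends. *)
Lemma weight_expansion (n : nat) : forall (b : bool) (W H : R -> R),
  weight (parity b) (parity b) n W H ->
  expansion n (fun m => quarter (fun x => W x * wave b (2 * INR m * x))).
Proof.
  pose proof PI_RGT_0 as Hpi.
  induction n as [|n IH]; intros b W H HW.
  - destruct b.
    + destruct (cos_integral_decay W) as [K [HK0 HK]]; [now apply weight_smooth in HW|].
      exists 0, K. split; [exact HK0|]. intros m Hm.
      replace (_ - _) with (quarter (fun x => W x * wave true (2 * INR m * x)))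
        by (unfold Rdiv; ring).
      now apply HK.
    + destruct (cos_integral_decay (Derive W)) as [K [HK0 HK]];
        [apply weight_smooth in HW; now apply smooth_Derive|].
      exists (- W (PI / 2)), K. split; [exact HK0|]. intros m Hm.
      assert (HM : 2 <= 2 * INR m)
        by (assert (INR 1 <= INR m) by (apply le_INR; lia); simpl in *; lra).
      rewrite by_parts_sin by (assumption || now apply weight_smooth in HW).
      destruct HW as (_ & _ & H0 & _). specialize (H0 0 ltac:(lra)).
      rewrite Ropp_0 in H0. simpl in H0. replace (W 0) with 0 by lra.
      replace (_ - _) with
        (quarter (fun x => Derive W x * wave true (2 * INR m * x)) / (2 * INR m))
        by (simpl; field; lra).
      unfold Rdiv at 1. rewrite Rabs_mult, (Rabs_pos_eq (/ _))
        by (left; apply Rinv_0_lt_compat; lra).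
      apply Rle_trans with (Rabs (quarter (fun x => Derive W x * wave true (2 * INR m * x))) * 1).
      * apply Rmult_le_compat_l; [apply Rabs_pos|].
        rewrite <- Rinv_1. apply Rinv_le_contravar; lra.
      * rewrite Rmult_1_r. now apply HK.
  - pose proof (weight_derive _ _ _ _ _ HW) as HD.
    assert (Hp : - parity b = parity (negb b)) by (destruct b; simpl; ring).
    rewrite Hp in HD. specialize (IH _ _ _ HD).
    destruct b; simpl negb in IH.
    + apply expansion_opp in IH. apply expansion_shift with (2 := IH). intros m Hm.
      rewrite by_parts_cos by (assumption || now apply weight_smooth in HW).
      unfold Rdiv. ring.
    + apply expansion_shift with (2 := IH). intros m Hm.
      rewrite by_parts_sin by (assumption || now apply weight_smooth in HW).
      destruct HW as (_ & _ & H0 & H1).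
      specialize (H0 0 ltac:(lra)). rewrite Ropp_0 in H0. simpl in H0.
      specialize (H1 (PI / 2) ltac:(lra)).
      replace (PI - PI / 2) with (PI / 2) in H1 by field.
      rewrite cos_PI2 in H1. simpl in H1. rewrite !Rmult_0_l in H1.
      replace (W 0) with 0 by lra. replace (W (PI / 2)) with 0 by lra.
      unfold Rdiv. ring.
Qed.

(** * Decay in the gap of two frequencies *)

Lemma omega_ge_3 (i : nat) : 3 <= omega i.
Proof. unfold omega. pose proof (pos_INR i). lra. Qed.

Lemma gap_eq (i j : nat) : (j < i)%nat -> omega i - omega j = 2 * INR (i - j).
Proof. intros H. unfold omega. rewrite minus_INR by lia. ring. Qed.

Lemma gap_ge_2 (i j : nat) : (j < i)%nat -> 2 <= omega i - omega j.
Proof.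
  intros H. rewrite gap_eq by exact H.
  assert (INR 1 <= INR (i - j)) by (apply le_INR; lia). simpl in *; lra.
Qed.

Lemma expansion_bound n I :
  expansion n I -> exists K, 0 <= K /\ forall m, (1 <= m)%nat ->
    Rabs (I m) <= K / (2 * INR m) ^ S n.
Proof.
  intros (c & K & HK & HI). exists (Rabs c + K).
  pose proof (Rabs_pos c). split; [lra|]. intros m Hm.
  assert (HM : 2 <= 2 * INR m)
    by (assert (INR 1 <= INR m) by (apply le_INR; lia); simpl in *; lra).
  set (M := 2 * INR m) in *. specialize (HI m Hm). fold M in HI.
  assert (Hp : 0 < / M ^ S n) by (apply Rinv_0_lt_compat, pow_lt; lra).
  assert (HK' : K / M ^ S (S n) <= K * / M ^ S n).
  { unfold Rdiv. apply Rmult_le_compat_l; [exact HK|].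
    apply Rinv_le_contravar; [apply pow_lt; lra|]. apply Rle_pow; [lra|lia]. }
  replace (I m) with ((I m - c * (-1) ^ m / M ^ S n) + c * (-1) ^ m / M ^ S n) by ring.
  eapply Rle_trans; [apply Rabs_triang|].
  unfold Rdiv at 2. rewrite !Rabs_mult, pow_1_abs, (Rabs_pos_eq (/ _)) by lra.
  unfold Rdiv at 2. rewrite Rmult_plus_distr_r. lra.
Qed.

Lemma pow_diff_bound (a b d : R) (q : nat) :
  0 < b <= a -> 0 <= d -> a - b <= d * a ^ 2 ->
  0 <= a ^ q - b ^ q <= INR q * d * a ^ S q.
Proof.
  intros Hab Hd H. induction q as [|q IH].
  - simpl. lra.
  - pose proof (pow_lt a q ltac:(lra)). pose proof (pow_lt b q ltac:(lra)).
    assert (b ^ q <= a ^ q) by lra.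
    replace (a ^ S q - b ^ S q) with (a * (a ^ q - b ^ q) + b ^ q * (a - b))
      by (simpl; ring).
    split.
    + apply Rplus_le_le_0_compat; apply Rmult_le_pos; lra.
    + rewrite S_INR.
      apply Rle_trans with (a * (INR q * d * a ^ S q) + a ^ q * (d * a ^ 2)).
      * apply Rplus_le_compat.
        -- apply Rmult_le_compat_l; lra.
        -- apply Rmult_le_compat; lra.
      * simpl. right. ring.
Qed.

Lemma sign_flip (i j : nat) : (j < i)%nat -> (-1) ^ (i + j + 3) = - (-1) ^ (i - j).
Proof.
  intros H. replace (i + j + 3)%nat with ((i - j) + (2 * (j + 1) + 1))%nat by lia.
  rewrite !pow_add, pow_1_even. simpl. ring.
Qed.

(** The frequencies [omega i - omega j] and [omega i + omega j] give the leading
    terms of an expansion opposite signs, and they differ by [2 * omega j], so a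
    power of the gap is gained at the price of a factor [omega j]. *)
Lemma expansion_cancel n I :
  expansion n I -> exists K, 0 <= K /\ forall i j, (j < i)%nat ->
    Rabs (I (i - j)%nat + I (i + j + 3)%nat)
      <= K * omega j / (omega i - omega j) ^ S (S n).
Proof.
  intros (c & K & HK & HI). exists (Rabs c * INR (S n) * 2 + 2 * K).
  pose proof (Rabs_pos c). pose proof (pos_INR (S n)).
  split; [assert (0 <= Rabs c * INR (S n)) by (apply Rmult_le_pos; lra); lra|].
  intros i j Hij.
  pose proof (HI (i - j)%nat ltac:(lia)) as H1.
  pose proof (HI (i + j + 3)%nat ltac:(lia)) as H2.
  rewrite <- gap_eq in H1 by exact Hij.
  replace (2 * INR (i + j + 3)) with (omega i + omega j) in H2
    by (unfold omega; rewrite !plus_INR; simpl; ring).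
  rewrite sign_flip in H2 by exact Hij.
  pose proof (gap_ge_2 i j Hij) as HM. pose proof (omega_ge_3 j) as Hj.
  set (M := omega i - omega j) in *.
  assert (HP : omega i + omega j = M + 2 * omega j) by (unfold M; ring).
  rewrite HP in H2. set (P := M + 2 * omega j) in *.
  set (s := (-1) ^ (i - j)) in *.
  assert (Hs : Rabs s = 1) by apply pow_1_abs.
  assert (HD : 0 <= (/ M) ^ S n - (/ P) ^ S n <= INR (S n) * (2 * omega j) * (/ M) ^ S (S n)).
  { assert (0 < / P) by (apply Rinv_0_lt_compat; unfold P; lra).
    assert (/ P <= / M) by (apply Rinv_le_contravar; unfold P; lra).
    apply pow_diff_bound; [lra|lra|].
    replace (/ M - / P) with (2 * omega j * (/ M * / P)) by (unfold P; field; lra).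
    apply Rmult_le_compat_l; [lra|]. simpl. rewrite Rmult_1_r.
    apply Rmult_le_compat_l; [|lra]. left; apply Rinv_0_lt_compat; lra. }
  rewrite !pow_inv in HD.
  assert (HKP : K / P ^ S (S n) <= K / M ^ S (S n)).
  { unfold Rdiv. apply Rmult_le_compat_l; [exact HK|].
    apply Rinv_le_contravar; [apply pow_lt; lra|]. apply pow_incr. unfold P; lra. }
  assert (HKj : K / M ^ S (S n) <= K * omega j / M ^ S (S n)).
  { unfold Rdiv. apply Rmult_le_compat_r.
    - left; apply Rinv_0_lt_compat, pow_lt; lra.
    - rewrite <- (Rmult_1_r K) at 1. apply Rmult_le_compat_l; lra. }
  replace (I (i - j)%nat + I (i + j + 3)%nat) with
    ((I (i - j)%nat - c * s / M ^ S n) + (I (i + j + 3)%nat - c * - s / P ^ S n)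
     + c * s * (/ M ^ S n - / P ^ S n)) by (unfold Rdiv; ring).
  eapply Rle_trans; [apply Rabs_triang|].
  eapply Rle_trans; [apply Rplus_le_compat_r, Rabs_triang|].
  rewrite (Rabs_mult (c * s)), (Rabs_mult c s), Hs, Rmult_1_r.
  rewrite (Rabs_pos_eq (/ _ - / _)) by lra.
  assert (HD' : Rabs c * (/ M ^ S n - / P ^ S n) <=
                Rabs c * (INR (S n) * (2 * omega j) * / M ^ S (S n)))
    by (apply Rmult_le_compat_l; lra).
  replace ((Rabs c * INR (S n) * 2 + 2 * K) * omega j / M ^ S (S n)) with
    (2 * (K * omega j / M ^ S (S n)) + Rabs c * (INR (S n) * (2 * omega j) * / M ^ S (S n)))
    by (unfold Rdiv; ring).
  lra.
Qed.

(** The uniform estimate behind both cases of the growth and decay statements. *)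
Definition decay (p : nat) (X : nat -> nat -> R) : Prop :=
  exists K, 0 <= K /\ (forall i j, Rabs (X i j) <= K) /\
    (forall i j, (j < i)%nat -> Rabs (X i j) <= K / (omega i - omega j) ^ p).

Lemma decay_ext p X Y : (forall i j, X i j = Y i j) -> decay p X -> decay p Y.
Proof.
  intros E (K & HK & HB & HD). exists K.
  split; [exact HK|split]; intros; rewrite <- E; auto.
Qed.

Lemma inv_gap_pos p i j : (j < i)%nat -> 0 < / (omega i - omega j) ^ p.
Proof. intros H. apply Rinv_0_lt_compat, pow_lt. pose proof (gap_ge_2 i j H). lra. Qed.

Lemma decay_plus p X Y :
  decay p X -> decay p Y -> decay p (fun i j => X i j + Y i j).
Proof.
  intros (K & HK & HB & HD) (L & HL & HB' & HD'). exists (K + L).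
  split; [lra|split].
  - intros i j. eapply Rle_trans; [apply Rabs_triang|]. now apply Rplus_le_compat.
  - intros i j H. unfold Rdiv. rewrite Rmult_plus_distr_r.
    eapply Rle_trans; [apply Rabs_triang|]. apply Rplus_le_compat; auto.
Qed.

Lemma decay_mul p (C : R) (r X : nat -> nat -> R) :
  (forall i j, Rabs (r i j) <= C) -> decay p X -> decay p (fun i j => r i j * X i j).
Proof.
  intros Hr (K & HK & HB & HD).
  assert (HC : 0 <= C) by (eapply Rle_trans; [apply Rabs_pos|apply (Hr 0%nat 0%nat)]).
  exists (C * K). split; [now apply Rmult_le_pos|split].
  - intros i j. rewrite Rabs_mult. apply Rmult_le_compat; auto using Rabs_pos.
  - intros i j H. rewrite Rabs_mult. unfold Rdiv. rewrite Rmult_assoc.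
    apply Rmult_le_compat; auto using Rabs_pos.
Qed.

Lemma decay_weaken p q X : (q <= p)%nat -> decay p X -> decay q X.
Proof.
  intros Hpq (K & HK & HB & HD). exists K. split; [exact HK|split; [exact HB|]].
  intros i j H. eapply Rle_trans; [now apply HD|]. pose proof (gap_ge_2 i j H).
  apply Rmult_le_compat_l; [exact HK|]. apply Rinv_le_contravar.
  - apply pow_lt; lra.
  - apply Rle_pow; [lra|exact Hpq].
Qed.

Lemma Rabs_inv_omega (i : nat) : Rabs (/ omega i) <= 1.
Proof.
  pose proof (omega_ge_3 i). rewrite Rabs_pos_eq.
  - rewrite <- Rinv_1. apply Rinv_le_contravar; lra.
  - left; apply Rinv_0_lt_compat; lra.
Qed.

Lemma decay_div_snd p X : decay p X -> decay p (fun i j => / omega j * X i j).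
Proof. apply decay_mul with 1. intros i j. apply Rabs_inv_omega. Qed.

Lemma decay_div_fst p X : decay p X -> decay (S p) (fun i j => / omega i * X i j).
Proof.
  intros HX. pose proof HX as (K & HK & HB & HD).
  exists K. split; [exact HK|split].
  - intros i j. rewrite Rabs_mult, <- (Rmult_1_l K).
    apply Rmult_le_compat; auto using Rabs_pos, Rabs_inv_omega.
  - intros i j H. pose proof (gap_ge_2 i j H). pose proof (omega_ge_3 j).
    rewrite <- div_shift by lra. rewrite Rabs_mult, Rmult_comm.
    apply Rmult_le_compat; auto using Rabs_pos.
    rewrite Rabs_pos_eq by (left; apply Rinv_0_lt_compat; lra).
    apply Rinv_le_contravar; lra.
Qed.

Definition mixed (b1 b2 : bool) (W : R -> R) (i j : nat) : R :=
  quarter (fun x => W x * (wave b1 (omega i * x) * wave b2 (omega j * x))).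

Lemma mixed_bounded b1 b2 W :
  smooth (- PI) PI W -> exists K, 0 <= K /\ forall i j, Rabs (mixed b1 b2 W i j) <= K.
Proof.
  intros HW. destruct (smooth_bounded W HW) as [K [HK0 HK]].
  exists (2 * K). split; [lra|]. intros i j. apply quarter_bound.
  - apply smooth_mult; [exact HW|]. apply smooth_mult; apply smooth_wave.
  - intros x Hx. rewrite !Rabs_mult. rewrite <- (Rmult_1_r K) at 1.
    pose proof (wave_le_1 b1 (omega i * x)). pose proof (wave_le_1 b2 (omega j * x)).
    apply Rmult_le_compat; [apply Rabs_pos| |now apply HK|].
    + apply Rmult_le_pos; apply Rabs_pos.
    + rewrite <- (Rmult_1_r 1). apply Rmult_le_compat; auto using Rabs_pos.
Qed.

Lemma wave_product_cos (b : bool) (u v : R) :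
  wave b u * wave true v = / 2 * wave b (u - v) + / 2 * wave b (u + v).
Proof.
  destruct b; simpl; [rewrite cos_minus, cos_plus|rewrite sin_minus, sin_plus]; field.
Qed.

Lemma wave_product_sin (b : bool) (u v : R) :
  wave b u * wave false v =
  parity (negb b) * (/ 2) * wave (negb b) (u - v)
  + parity b * (/ 2) * wave (negb b) (u + v).
Proof.
  destruct b; simpl; [rewrite sin_minus, sin_plus|rewrite cos_minus, cos_plus]; field.
Qed.

Lemma mixed_split (b1 b2 c : bool) (W : R -> R) (k l : R) (i j : nat) :
  smooth (- PI) PI W -> (j < i)%nat ->
  (forall u v, wave b1 u * wave b2 v = k * wave c (u - v) + l * wave c (u + v)) ->
  mixed b1 b2 W i j =
  k * quarter (fun x => W x * wave c (2 * INR (i - j) * x))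
  + l * quarter (fun x => W x * wave c (2 * INR (i + j + 3) * x)).
Proof.
  intros HW Hij E. unfold mixed.
  assert (HS : forall w, smooth (- PI) PI (fun x => W x * wave c (w * x)))
    by (intros w; apply smooth_mult; [exact HW|apply smooth_wave]).
  assert (HS' : forall a w, smooth (- PI) PI (fun x => a * (W x * wave c (w * x))))
    by (intros a w; apply smooth_mult; [apply smooth_const|apply HS]).
  rewrite <- (quarter_scal k _ (HS (2 * INR (i - j)))),
    <- (quarter_scal l _ (HS (2 * INR (i + j + 3)))),
    <- (quarter_plus _ _ (HS' k _) (HS' l _)).
  apply quarter_ext. intros x _. rewrite E, <- (gap_eq i j Hij).
  replace (2 * INR (i + j + 3)) with (omega i + omega j)
    by (unfold omega; rewrite !plus_INR; simpl; ring).
  rewrite Rmult_minus_distr_r, Rmult_plus_distr_r. ring.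
Qed.

(** Equal flags give cosines of the two combined frequencies and call for a
    symmetric weight; different flags give sines and call for an antisymmetric one. *)
Lemma decay_mixed b1 b2 n W H :
  weight (parity (Bool.eqb b1 b2)) (parity (Bool.eqb b1 b2)) n W H ->
  decay (S n) (mixed b1 b2 W).
Proof.
  intros HW. pose proof (weight_smooth _ _ _ _ _ HW) as HS.
  destruct (mixed_bounded b1 b2 W HS) as [L [HL0 HL]].
  destruct (expansion_bound _ _ (weight_expansion _ _ _ _ HW)) as [K [HK0 HK]].
  exists (L + K). split; [lra|split].
  - intros i j. specialize (HL i j). lra.
  - intros i j Hij. pose proof (gap_ge_2 i j Hij) as HM.
    pose proof (omega_ge_3 j).
    pose proof (HK (i - j)%nat ltac:(lia)) as H1.
    pose proof (HK (i + j + 3)%nat ltac:(lia)) as H2. cbv beta in H1, H2.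
    assert (E : exists k l, Rabs k = / 2 /\ Rabs l = / 2 /\
      forall u v, wave b1 u * wave b2 v =
        k * wave (Bool.eqb b1 b2) (u - v) + l * wave (Bool.eqb b1 b2) (u + v)).
    { destruct b2.
      - exists (/ 2), (/ 2). rewrite Rabs_pos_eq by lra. repeat split.
        intros u v. rewrite wave_product_cos. now destruct b1.
      - exists (parity (negb b1) * / 2), (parity b1 * / 2).
        rewrite !Rabs_mult, (Rabs_pos_eq (/ 2)) by lra.
        assert (Hp : forall b, Rabs (parity b) = 1)
          by (intros []; unfold parity, Rabs; destruct Rcase_abs; lra).
        rewrite !Hp. repeat split; try ring.
        intros u v. rewrite wave_product_sin. now destruct b1. }
    destruct E as (k & l & Hk & Hl & E).
    rewrite (mixed_split b1 b2 _ W k l i j HS Hij E).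
    eapply Rle_trans; [apply Rabs_triang|]. rewrite !Rabs_mult, Hk, Hl.
    assert (K / (2 * INR (i + j + 3)) ^ S n <= K / (omega i - omega j) ^ S n).
    { apply Rmult_le_compat_l; [exact HK0|]. apply Rinv_le_contravar.
      - apply pow_lt; lra.
      - apply pow_incr. split; [lra|]. unfold omega in *. rewrite !plus_INR. simpl. lra. }
    rewrite <- gap_eq in H1 |- * by exact Hij.
    assert (0 <= L / (omega i - omega j) ^ S n).
    { apply Rmult_le_pos; [exact HL0|]. left; now apply inv_gap_pos. }
    unfold Rdiv at 1. rewrite Rmult_plus_distr_r. unfold Rdiv in *. lra.
Qed.

(** A cosine of the smaller frequency makes the difference and the sum of the
    frequencies enter with the same sign, which is the case of cancellation. *)
Lemma decay_mixed_cancel b n W H :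
  weight (parity b) (parity b) n W H ->
  decay (S (S n)) (fun i j => / omega j * mixed b true W i j).
Proof.
  intros HW. pose proof (weight_smooth _ _ _ _ _ HW) as HS.
  destruct (mixed_bounded b true W HS) as [L [HL0 HL]].
  destruct (expansion_cancel _ _ (weight_expansion _ _ _ _ HW)) as [K [HK0 HK]].
  exists (L + K). split; [lra|split].
  - intros i j. specialize (HL i j). rewrite Rabs_mult.
    pose proof (Rabs_inv_omega j).
    apply Rle_trans with (1 * L); [|lra].
    apply Rmult_le_compat; auto using Rabs_pos.
  - intros i j Hij. pose proof (HK i j Hij) as H1. cbv beta in H1.
    rewrite (mixed_split b true b W (/ 2) (/ 2) i j HS Hij (wave_product_cos b)).
    rewrite <- Rmult_plus_distr_l, !Rabs_mult.
    pose proof (omega_ge_3 j). rewrite (Rabs_pos_eq (/ 2)) by lra.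
    rewrite Rabs_pos_eq by (left; apply Rinv_0_lt_compat; lra).
    set (Z := Rabs (_ + _)) in *.
    assert (HZ : / omega j * Z <= K / (omega i - omega j) ^ S (S n)).
    { apply Rmult_le_reg_l with (omega j); [lra|].
      rewrite <- Rmult_assoc, Rinv_r, Rmult_1_l by lra.
      eapply Rle_trans; [exact H1|]. right. unfold Rdiv. ring. }
    assert (0 <= / omega j * Z).
    { apply Rmult_le_pos; [left; apply Rinv_0_lt_compat; lra|apply Rabs_pos]. }
    assert (0 <= L / (omega i - omega j) ^ S (S n)).
    { apply Rmult_le_pos; [exact HL0|]. left; now apply inv_gap_pos. }
    unfold Rdiv at 1. rewrite Rmult_plus_distr_r. unfold Rdiv in *. lra.
Qed.

Lemma estimate_a_of_decay p X : decay p X -> estimate_a p X.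
Proof.
  intros (K & HK & HB & HD) i j Hi Hj. split.
  - intros _. exists K. apply filter_forall. intros n.
    rewrite Rabs_mult, Rmult_comm. apply Rmult_le_compat_r; [apply Rabs_pos|apply HB].
  - intros Hlim. exists K.
    assert (He : eventually (fun n => (j n < i n)%nat)).
    { apply is_lim_seq_spec in Hlim. apply filter_imp with (2 := Hlim 0).
      intros n Hn. unfold omega in Hn. apply INR_lt. lra. }
    apply filter_imp with (2 := He). intros n Hn.
    specialize (HD _ _ Hn). pose proof (inv_gap_pos p _ _ Hn).
    rewrite Rabs_mult. unfold Rdiv. rewrite !Rabs_mult.
    rewrite (Rabs_pos_eq (/ (omega (i n) - omega (j n)) ^ p)) by lra.
    pose proof (Rabs_pos (omega (i n))).
    assert (0 <= K * (Rabs (omega (i n)) * Rabs (/ (omega (i n) + omega (j n)) ^ p)))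
      by (repeat apply Rmult_le_pos; auto using Rabs_pos).
    assert (Rabs (omega (i n)) * Rabs (X (i n) (j n)) <=
            Rabs (omega (i n)) * (K / (omega (i n) - omega (j n)) ^ p))
      by (apply Rmult_le_compat_l; assumption).
    unfold Rdiv in *. lra.
Qed.

Lemma estimate_b_of_decay p Y :
  decay p (fun i j => omega i * Y i j) -> estimate_b p Y.
Proof.
  intros (K & HK & HB & HD) i j Hi Hj.
  assert (E : forall a b, Rabs (Y a b) = Rabs (/ omega a) * Rabs (omega a * Y a b)).
  { intros a b. pose proof (omega_ge_3 a). rewrite <- Rabs_mult. f_equal. field. lra. }
  split.
  - intros _. exists K. apply filter_forall. intros n.
    rewrite E, Rmult_comm. apply Rmult_le_compat_r; [apply Rabs_pos|apply HB].
  - intros Hlim. exists K.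
    assert (He : eventually (fun n => (j n < i n)%nat)).
    { apply is_lim_seq_spec in Hlim. apply filter_imp with (2 := Hlim 0).
      intros n Hn. unfold omega in Hn. apply INR_lt. lra. }
    apply filter_imp with (2 := He). intros n Hn.
    specialize (HD _ _ Hn). pose proof (inv_gap_pos p _ _ Hn).
    rewrite E. unfold Rdiv. rewrite !(Rabs_mult (/ omega (i n))).
    rewrite (Rabs_pos_eq (/ (omega (i n) - omega (j n)) ^ p)) by lra.
    pose proof (Rabs_pos (/ omega (i n))).
    assert (0 <= K * (Rabs (/ omega (i n)) * Rabs (/ (omega (i n) + omega (j n)) ^ p)))
      by (repeat apply Rmult_le_pos; auto using Rabs_pos).
    assert (Rabs (/ omega (i n)) * Rabs (omega (i n) * Y (i n) (j n)) <=
            Rabs (/ omega (i n)) * (K / (omega (i n) - omega (j n)) ^ p))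
      by (apply Rmult_le_compat_l; assumption).
    unfold Rdiv in *. lra.
Qed.

(** * The first non-vanishing odd derivative of a weight *)

Lemma Derive_n_S_shift (f : R -> R) (n : nat) (x : R) :
  Derive_n f (S n) x = Derive_n (Derive f) n x.
Proof.
  change (Derive f) with (Derive_n f 1). now rewrite Derive_n_comp, Nat.add_1_r.
Qed.

(** [Nat.odd q = b] selects the derivatives that the symmetry kills: the odd ones
    of a symmetric weight and the even ones of an antisymmetric weight. *)
Lemma weight_derivatives (n : nat) : forall (b : bool) (W H : R -> R),
  weight (parity b) (parity b) n W H ->
  (forall q, Nat.odd q = b -> Derive_n W q 0 = 0) /\
  (forall q, (q < n)%nat -> Nat.odd q = b -> Derive_n W q (PI / 2) = 0) /\
  (Nat.odd n = b -> H (PI / 2) <> 0 -> Derive_n W n (PI / 2) <> 0).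
Proof.
  pose proof PI_RGT_0 as Hpi.
  assert (H0' : forall q (b : bool) (W : R -> R), smooth (- PI) PI W ->
    (forall x, - PI < x < PI -> W (- x) = parity b * W x) ->
    Nat.odd q = b -> Derive_n W q 0 = 0).
  { induction q as [|q IH]; intros b W HW H0 Hq.
    - specialize (H0 0 ltac:(lra)). rewrite Ropp_0 in H0.
      rewrite <- Hq in H0. simpl in H0. simpl. lra.
    - rewrite Derive_n_S_shift. apply (IH (negb b)).
      + now apply smooth_Derive.
      + intros x Hx. rewrite (Derive_parity _ W HW H0 x Hx). now destruct b; simpl; ring_simplify.
      + rewrite Nat.odd_succ, <- Nat.negb_odd in Hq. now rewrite <- Hq, Bool.negb_involutive. }
  induction n as [|n IH]; intros b W H HW.
  - split; [|split].
    + intros q. destruct HW as (A & _ & B & _). now apply H0'.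
    + intros q Hq; lia.
    + intros Hb HH. destruct HW as (_ & _ & _ & H1). simpl in *.
      specialize (H1 (PI / 2) ltac:(lra)).
      replace (PI - PI / 2) with (PI / 2) in H1 by field.
      rewrite <- Hb in H1. simpl in H1. lra.
  - assert (Hp : - parity b = parity (negb b)) by (destruct b; simpl; ring).
    pose proof (weight_derive _ _ _ _ _ HW) as HD. rewrite Hp in HD.
    destruct (IH _ _ _ HD) as (_ & I1 & I2).
    split; [|split].
    + intros q. destruct HW as (A & _ & B & _). now apply H0'.
    + intros [|q] Hq Hb.
      * destruct HW as (_ & _ & _ & H1).
        specialize (H1 (PI / 2) ltac:(lra)).
        replace (PI - PI / 2) with (PI / 2) in H1 by field.
        rewrite cos_PI2, <- Hb in H1. simpl in H1. simpl. lra.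
      * rewrite Derive_n_S_shift. apply I1; [lia|].
        rewrite Nat.odd_succ, <- Nat.negb_odd in Hb. now rewrite <- Hb, Bool.negb_involutive.
    + intros Hb HH. rewrite Derive_n_S_shift. apply I2.
      * rewrite Nat.odd_succ, <- Nat.negb_odd in Hb. now rewrite <- Hb, Bool.negb_involutive.
      * rewrite cos_PI2, sin_PI2.
        pose proof (pos_INR n). rewrite S_INR.
        intros E. apply HH. apply Rmult_eq_reg_l with (INR n + 1); [|lra]. lra.
Qed.

Lemma smooth_Derive_n (a b : R) (f : R -> R) (n : nat) :
  smooth a b f -> smooth a b (Derive_n f n).
Proof.
  intros Hf. induction n as [|n IH]; [exact Hf|]. simpl. now apply smooth_Derive.
Qed.

(** [F] is only given on the open interval; the weight is its smooth extension, so
    its derivatives at the end points are the one-sided limits. *)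
Lemma weight_first_nonvanishing (n : nat) (F W H : R -> R) :
  weight 1 1 n W H -> Nat.Odd n -> H (PI / 2) <> 0 ->
  (forall x, 0 < x < PI / 2 -> F x = W x) -> first_nonvanishing n F.
Proof.
  intros HW Hn HH HF. pose proof PI_RGT_0 as Hpi.
  pose proof (weight_smooth _ _ _ _ _ HW) as HS.
  destruct (weight_derivatives n true W H HW) as (D0 & D1 & D2).
  assert (HE : forall q x, 0 < x < PI / 2 -> Derive_n F q x = Derive_n W q x).
  { intros q x Hx. apply Derive_n_ext_loc.
    now apply (locally_open_interval 0 (PI / 2)). }
  assert (L : forall q x0 (D : (R -> Prop) -> Prop), Filter D ->
    - PI < x0 < PI -> filterlim (fun x => x) D (locally x0) ->
    D (fun x => 0 < x < PI / 2) ->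
    filterlim (Derive_n F q) D (locally (Derive_n W q x0))).
  { intros q x0 D FD Hx0 HD Hin.
    apply filterlim_ext_loc with (Derive_n W q).
    - apply filter_imp with (2 := Hin). intros x Hx. symmetry. now apply HE.
    - apply filterlim_comp with (G := locally x0) (f := fun x => x); [exact HD|].
      apply (smooth_continuous (- PI) PI); [now apply smooth_Derive_n|exact Hx0]. }
  assert (L0 : forall q, filterlim (Derive_n F q) (at_right 0) (locally (Derive_n W q 0))).
  { intros q. apply L; [typeclasses eauto|lra| |].
    - intros P HP. unfold filtermap. now apply filter_le_within.
    - apply (locally_open_interval (- (PI / 2)) (PI / 2)); [lra|].
      intros y Hy Hy0. lra. }
  assert (L1 : forall q, filterlim (Derive_n F q) (at_left (PI / 2))
                           (locally (Derive_n W q (PI / 2)))).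
  { intros q. apply L; [typeclasses eauto|lra| |].
    - intros P HP. unfold filtermap. now apply filter_le_within.
    - apply (locally_open_interval 0 PI); [lra|].
      intros y Hy Hy0. lra. }
  split; [|split].
  - intros x Hx q _. apply ex_derive_n_ext_loc with W.
    + apply (locally_open_interval 0 (PI / 2)); [exact Hx|].
      intros y Hy. symmetry. now apply HF.
    + apply HS. lra.
  - intros q Hq Hodd. apply Nat.odd_spec in Hodd. split.
    + pose proof (L0 q) as E. now rewrite (D0 q Hodd) in E.
    + pose proof (L1 q) as E. now rewrite (D1 q Hq Hodd) in E.
  - exists (Derive_n W n (PI / 2)). split; [|apply L1].
    apply D2; [now apply Nat.odd_spec|exact HH].
Qed.

(** * Primitives of trigonometric monomials *)

(** Lemmas on integrals leave their equations in the carrier of a normed module,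
    where [ring] does not recognise real numbers. *)
Ltac real_eq := match goal with |- @eq _ ?a ?b => change (@eq R a b) end.

(** Matching on the syntax keeps unification from unfolding sine and cosine. *)
Ltac smooth_auto :=
  lazymatch goal with
  | |- smooth _ _ (fun _ => ?c) => apply smooth_const
  | |- smooth _ _ (fun x => x) => apply smooth_id
  | |- smooth _ _ (fun x => sin x) => apply smooth_sin
  | |- smooth _ _ (fun x => cos x) => apply smooth_cos
  | |- smooth _ _ (fun x => wave _ (_ * x)) => apply smooth_wave
  | |- smooth _ _ (fun x => sin (_ * x)) => apply smooth_sin_lin
  | |- smooth _ _ (fun x => cos (_ * x)) => apply smooth_cos_lin
  | |- smooth ?a ?b (fun x => @?f x - @?g x) => apply (smooth_minus a b f g); smooth_auto
  | |- smooth ?a ?b (fun x => @?f x + @?g x) => apply (smooth_plus a b f g); smooth_auto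
  | |- smooth ?a ?b (fun x => @?f x * @?g x) => apply (smooth_mult a b f g); smooth_auto
  | |- smooth ?a ?b (fun x => - @?f x) => apply (smooth_opp a b f); smooth_auto
  | |- smooth ?a ?b (fun x => @?f x ^ ?n) => apply (smooth_pow a b f n); smooth_auto
  | |- smooth ?a ?b (fun x => @?f x / @?g x) =>
      apply (smooth_div a b f g); [smooth_auto|smooth_auto|]
  | |- smooth ?a ?b (fun x => / @?f x) => apply (smooth_inv a b f); [smooth_auto|]
  | |- _ => try assumption
  end.

Definition sinc : R -> R := dilation 0 (fun x => cos x).

Lemma smooth_sinc (b : R) : smooth (- b) b sinc.
Proof. apply smooth_dilation, smooth_cos. Qed.

Lemma sin_sinc (x : R) : sin x = x * sinc x.
Proof.
  transitivity (RInt (fun y => y ^ 0 * cos y) 0 x).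
  - symmetry. apply is_RInt_unique.
    replace (sin x) with (minus (sin x) (sin 0))
      by (rewrite sin_0; unfold minus, plus, opp; simpl; ring).
    apply (is_RInt_derive (V := R_CompleteNormedModule)).
    + intros y _. auto_derive; [exact I|simpl; ring].
    + intros y _. apply (smooth_continuous (y - 1) (y + 1)); [smooth_auto|lra].
  - rewrite (RInt_dilation (Rabs x + 1) 0 (fun x => cos x) x);
      [unfold sinc; ring|apply smooth_cos|].
    unfold Rabs. destruct Rcase_abs; lra.
Qed.

Lemma sinc_neq_0 (x : R) : - PI < x < PI -> sinc x <> 0.
Proof.
  intros Hx. destruct (Req_dec x 0) as [->|Hx0].
  - apply Rgt_not_eq. apply (dilation_gt_0 1); [apply smooth_cos|lra|].
    intros t _. rewrite Rmult_0_l, cos_0. lra.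
  - intros E. pose proof (sin_sinc x) as Es. rewrite E, Rmult_0_r in Es.
    destruct (Rlt_or_le 0 x) as [H|H].
    + pose proof (sin_gt_0 x). lra.
    + pose proof (sin_gt_0 (- x)). rewrite sin_neg in *. lra.
Qed.

Lemma sinc_even (x : R) : sinc (- x) = sinc x.
Proof. apply dilation_even. intros t _. apply cos_neg. Qed.

(** The primitive of [sin ^ m * cos ^ p] vanishes at the origin to order [m + 1];
    this is its quotient by [sin ^ (m + 1)], a smooth even function. *)
Definition reduced_primitive (m p : nat) (x : R) : R :=
  dilation m (fun y => sinc y ^ m * cos y ^ p) x / sinc x ^ S m.

Lemma smooth_reduced_primitive m p : smooth (- PI) PI (reduced_primitive m p).
Proof.
  apply smooth_div.
  - apply smooth_dilation. apply smooth_mult; apply smooth_pow; [apply smooth_sinc|apply smooth_cos].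
  - apply smooth_pow, smooth_sinc.
  - intros x Hx. apply pow_nonzero. now apply sinc_neq_0.
Qed.

Lemma RInt_reduced_primitive m p x : - PI < x < PI ->
  RInt (fun y => sin y ^ m * cos y ^ p) 0 x = sin x ^ S m * reduced_primitive m p x.
Proof.
  intros Hx.
  transitivity (RInt (fun y => y ^ m * (sinc y ^ m * cos y ^ p)) 0 x).
  - apply RInt_ext. intros y _. rewrite sin_sinc, Rpow_mult_distr. apply Rmult_assoc.
  - rewrite (RInt_dilation PI m (fun y => sinc y ^ m * cos y ^ p) x); [|  |exact Hx].
    + unfold reduced_primitive. rewrite sin_sinc, Rpow_mult_distr.
      pose proof (pow_nonzero _ (S m) (sinc_neq_0 x Hx)) as Hn.
      set (d := sinc x ^ S m) in *. real_eq. field. exact Hn.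
    + apply smooth_mult; apply smooth_pow; [apply smooth_sinc|apply smooth_cos].
Qed.

Lemma reduced_primitive_even m p x : reduced_primitive m p (- x) = reduced_primitive m p x.
Proof.
  unfold reduced_primitive. rewrite sinc_even. f_equal. apply dilation_even.
  intros t _. now rewrite sinc_even, cos_neg.
Qed.

Lemma reduced_primitive_0_gt_0 m p : 0 < reduced_primitive m p 0.
Proof.
  assert (Hs : 0 < sinc 0).
  { apply (dilation_gt_0 1); [apply smooth_cos|lra|].
    intros t _. rewrite Rmult_0_l, cos_0. lra. }
  unfold reduced_primitive. apply Rdiv_lt_0_compat; [|now apply pow_lt].
  apply (dilation_gt_0 1); [|lra|].
  - apply smooth_mult; apply smooth_pow; [apply smooth_sinc|apply smooth_cos].
  - intros t _. rewrite Rmult_0_l, cos_0, pow1, Rmult_1_r. now apply pow_lt.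
Qed.

(** With these, [Gam1] is [9 * e 0 0 ^ 2 * cos ^ 3 * sin ^ 4 * Q1] and [Gam2] is
    [9 * e 0 0 ^ 2 * cos ^ 3 * sin ^ 2 * Q2], with no division by the sine left. *)
Definition Q1 : R -> R := reduced_primitive 4 2.
Definition Q2 : R -> R := reduced_primitive 2 4.

Lemma sin_sq (x : R) : sin x ^ 2 = 1 - cos x ^ 2.
Proof. pose proof (sin2_cos2 x) as E. unfold Rsqr in E. simpl. lra. Qed.

Lemma RInt_trig (f F : R -> R) (x : R) :
  F 0 = 0 -> (forall y, is_derive F y (f y)) -> (forall y, continuous f y) ->
  RInt f 0 x = F x.
Proof.
  intros F0 HF Hf. apply is_RInt_unique.
  replace (F x) with (minus (F x) (F 0))
    by (rewrite F0; unfold minus, plus, opp; simpl; ring).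
  apply (is_RInt_derive (V := R_CompleteNormedModule)); intros; auto.
Qed.

Lemma Q1_primitive (x : R) : - PI < x < PI ->
  sin x ^ 5 * Q1 x =
  (x - sin x * cos x * (1 + 2 / 3 * sin x ^ 2 - 8 / 3 * sin x ^ 4)) / 16.
Proof.
  intros Hx. unfold Q1. rewrite <- RInt_reduced_primitive by exact Hx.
  apply (RInt_trig _ (fun x => (x - sin x * cos x *
           (1 + 2 / 3 * sin x ^ 2 - 8 / 3 * sin x ^ 4)) / 16)).
  - rewrite sin_0. field.
  - intros y. auto_derive; [exact I|].
    pose proof (sin_sq y) as E. simpl.
    replace (cos y * (cos y * 1)) with (1 - sin y * sin y) by (simpl in E; lra).
    assert (E' : cos y * cos y = 1 - sin y * sin y) by (simpl in E; lra).
    field_simplify; [|lra..].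
    replace (cos y ^ 2) with (1 - sin y ^ 2) by lra. field.
  - intros y. apply (smooth_continuous (y - 1) (y + 1)); [smooth_auto|lra].
Qed.

Lemma Q2_primitive (x : R) : - PI < x < PI ->
  sin x ^ 3 * Q2 x =
  (x - sin x * cos x * (1 - 14 / 3 * sin x ^ 2 + 8 / 3 * sin x ^ 4)) / 16.
Proof.
  intros Hx. unfold Q2. rewrite <- RInt_reduced_primitive by exact Hx.
  apply (RInt_trig _ (fun x => (x - sin x * cos x *
           (1 - 14 / 3 * sin x ^ 2 + 8 / 3 * sin x ^ 4)) / 16)).
  - rewrite sin_0. field.
  - intros y. auto_derive; [exact I|].
    pose proof (sin_sq y) as E.
    replace (cos y ^ 4) with ((1 - sin y ^ 2) ^ 2) by (rewrite E; ring).
    simpl pred. simpl INR. field_simplify; [|lra..].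
    replace (cos y ^ 2) with (1 - sin y ^ 2) by lra. field.
  - intros y. apply (smooth_continuous (y - 1) (y + 1)); [smooth_auto|lra].
Qed.

Lemma sin_pos (x : R) : 0 < x < PI -> 0 < sin x.
Proof. intros Hx. apply sin_gt_0; lra. Qed.

(** The primitive taken at [PI - x] is its value [PI / 16] at [PI] minus its value
    at [x]. *)
Lemma Q1_reflect (x : R) : 0 < x < PI -> Q1 (PI - x) = PI / 16 / sin x ^ 5 - Q1 x.
Proof.
  intros Hx. pose proof (sin_pos x Hx) as Hs.
  pose proof (Q1_primitive x ltac:(lra)) as E1.
  pose proof (Q1_primitive (PI - x) ltac:(lra)) as E2.
  rewrite sin_PI_x, cos_PI_minus in E2.
  assert (Hp : 0 < sin x ^ 5) by (now apply pow_lt).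
  apply Rmult_eq_reg_l with (sin x ^ 5); [|lra].
  replace (sin x ^ 5 * (PI / 16 / sin x ^ 5 - Q1 x)) with (PI / 16 - sin x ^ 5 * Q1 x)
    by (field; lra).
  rewrite E1, E2. field.
Qed.

Lemma Q2_reflect (x : R) : 0 < x < PI -> Q2 (PI - x) = PI / 16 / sin x ^ 3 - Q2 x.
Proof.
  intros Hx. pose proof (sin_pos x Hx) as Hs.
  pose proof (Q2_primitive x ltac:(lra)) as E1.
  pose proof (Q2_primitive (PI - x) ltac:(lra)) as E2.
  rewrite sin_PI_x, cos_PI_minus in E2.
  assert (Hp : 0 < sin x ^ 3) by (now apply pow_lt).
  apply Rmult_eq_reg_l with (sin x ^ 3); [|lra].
  replace (sin x ^ 3 * (PI / 16 / sin x ^ 3 - Q2 x)) with (PI / 16 - sin x ^ 3 * Q2 x)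
    by (field; lra).
  rewrite E1, E2. field.
Qed.

(** Exchanging sine and cosine exchanges the two primitives. *)
Lemma Q1_complement (x : R) : 0 < x < PI ->
  PI / 16 - 2 * (sin x ^ 5 * Q1 x) = 2 * (cos x ^ 3 * Q2 (PI / 2 - x)).
Proof.
  intros Hx. pose proof PI_RGT_0.
  pose proof (Q1_primitive x ltac:(lra)) as E1.
  pose proof (Q2_primitive (PI / 2 - x) ltac:(lra)) as E2.
  rewrite sin_shift, cos_shift in E2. rewrite E1, E2.
  replace (cos x ^ 4) with ((1 - sin x ^ 2) ^ 2) by (rewrite sin_sq; ring).
  replace (cos x ^ 2) with (1 - sin x ^ 2) by (rewrite sin_sq; ring). field.
Qed.

Lemma Q2_complement (x : R) : 0 < x < PI ->
  PI / 16 - 2 * (sin x ^ 3 * Q2 x) = 2 * (cos x ^ 5 * Q1 (PI / 2 - x)).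
Proof.
  intros Hx. pose proof PI_RGT_0.
  pose proof (Q2_primitive x ltac:(lra)) as E1.
  pose proof (Q1_primitive (PI / 2 - x) ltac:(lra)) as E2.
  rewrite sin_shift, cos_shift in E2. rewrite E1, E2.
  replace (cos x ^ 4) with ((1 - sin x ^ 2) ^ 2) by (rewrite sin_sq; ring).
  replace (cos x ^ 2) with (1 - sin x ^ 2) by (rewrite sin_sq; ring). field.
Qed.

(** * The Gamma function at half-integers *)

Lemma positive_ends (P : R -> Prop) :
  (forall t, 0 < t -> P t) ->
  filter_prod (at_right 0) (Rbar_locally p_infty)
    (fun ab => forall x, Rmin (fst ab) (snd ab) <= x <= Rmax (fst ab) (snd ab) -> P x).
Proof.
  intros HP.
  apply Filter_prod with (Q := fun a => 0 < a) (R := fun b => 0 < b).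
  - exists (mkposreal 1 Rlt_0_1). intros y _ Hy. exact Hy.
  - exists 0. auto.
  - intros a b Ha Hb x [Hx _]. apply HP.
    apply Rlt_le_trans with (2 := Hx). now apply Rmin_glb_lt.
Qed.

Lemma is_RInt_gen_primitive (f F : R -> R) (la lb : R) :
  (forall t, 0 < t -> is_derive F t (f t)) -> (forall t, 0 < t -> continuous f t) ->
  filterlim F (at_right 0) (locally la) ->
  filterlim F (Rbar_locally p_infty) (locally lb) ->
  is_RInt_gen f (at_right 0) (Rbar_locally p_infty) (lb - la).
Proof.
  intros HF Hf La Lb.
  assert (HD : forall t, 0 < t -> Derive F t = f t)
    by (intros; now apply is_derive_unique, HF).
  apply is_RInt_gen_ext with (Derive F).
  - apply filter_imp with (2 := positive_ends (fun t => Derive F t = f t) HD).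
    intros ab Hab x Hx. apply Hab. lra.
  - apply is_RInt_gen_Derive; try assumption.
    + apply positive_ends. intros t Ht. eexists. now apply HF.
    + apply positive_ends. intros t Ht. apply continuous_ext_loc with f; [|now apply Hf].
      apply (locally_open_interval 0 (t + 1)); [lra|]. intros y Hy. symmetry. apply HD. lra.
Qed.

Lemma filterlim_le_p_infty_bounded (F : R -> R) (M : R) :
  (forall x y, 0 <= x <= y -> F x <= F y) -> (forall x, 0 <= x -> F x <= M) ->
  exists L, F 1 <= L /\ filterlim F (Rbar_locally p_infty) (locally L).
Proof.
  intros Hinc HM.
  destruct (completeness (fun y => exists x, 0 <= x /\ y = F x)) as [L [HL1 HL2]].
  - exists M. intros y [x [Hx ->]]. now apply HM.
  - exists (F 1), 1. split; [lra|reflexivity].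
  - exists L. split; [apply HL1; exists 1; split; [lra|reflexivity]|].
    apply filterlim_locally. intros eps.
    assert (exists x0, 0 <= x0 /\ L - eps < F x0) as [x0 [Hx0 Hx0']].
    { apply Classical_Prop.NNPP. intros Hn.
      assert (L <= L - eps).
      { apply HL2. intros y [x [Hx ->]]. apply Rnot_lt_le. intros H. apply Hn. now exists x. }
      pose proof (cond_pos eps). lra. }
    exists x0. intros x Hx. unfold ball; simpl; unfold AbsRing_ball, abs, minus, plus, opp; simpl.
    assert (F x0 <= F x) by (apply Hinc; lra).
    assert (F x <= L) by (apply HL1; exists x; split; [lra|reflexivity]).
    apply Rabs_def1; lra.
Qed.

(** The square root is continuous on the whole line, so that only the end at
    infinity is improper, and there the primitive is increasing and bounded. *)
Lemma Gamma_three_half_integral :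
  exists L, 0 < L /\
    is_RInt_gen (fun t => Rpower t (1 / 2) * exp (- t))
      (at_right 0) (Rbar_locally p_infty) L.
Proof.
  set (f := fun t => sqrt t * exp (- t)).
  assert (Hc : forall t, continuous f t).
  { intros t. apply (continuous_mult (K := R_AbsRing)); [apply continuous_sqrt|].
    apply (ex_derive_continuous (V := R_NormedModule)). auto_derive. exact I. }
  assert (Hex : forall a b, ex_RInt f a b).
  { intros a b. apply (ex_RInt_continuous (V := R_CompleteNormedModule)). auto. }
  set (F := fun x => RInt f 0 x).
  assert (HF : forall t, is_derive F t (f t)).
  { intros t. apply (is_derive_RInt (V := R_NormedModule) f F 0 t); [|apply Hc].
    apply filter_forall. intros x. apply (RInt_correct (V := R_CompleteNormedModule)), Hex. }
  assert (Hsplit : forall x y, F y = F x + RInt f x y).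
  { intros x y. symmetry.
    apply (RInt_Chasles (V := R_CompleteNormedModule)); apply Hex. }
  assert (Hf0 : forall t, 0 <= f t).
  { intros t. apply Rmult_le_pos; [apply sqrt_pos|left; apply exp_pos]. }
  destruct (filterlim_le_p_infty_bounded F 2) as [L [HL1 HL]].
  - intros x y Hxy. rewrite (Hsplit x y).
    assert (0 <= RInt f x y) by (apply RInt_ge_0; [lra|apply Hex|intros; apply Hf0]). lra.
  - (* [sqrt t <= 1 + t], and [(1 + t) * exp (- t)] has an explicit primitive. *)
    intros x Hx.
    assert (HI : is_RInt (fun t => (1 + t) * exp (- t)) 0 x
                   (minus (- (2 + x) * exp (- x)) (- (2 + 0) * exp (- 0)))).
    { apply (is_RInt_derive (V := R_CompleteNormedModule)
               (fun t => - (2 + t) * exp (- t))).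
      - intros t _. auto_derive; [exact I|ring].
      - intros t _. apply (ex_derive_continuous (V := R_NormedModule)).
        auto_derive. exact I. }
    apply Rle_trans with (minus (- (2 + x) * exp (- x)) (- (2 + 0) * exp (- 0))).
    + apply (is_RInt_le f (fun t => (1 + t) * exp (- t)) 0 x); [exact Hx| |exact HI|].
      * apply (RInt_correct (V := R_CompleteNormedModule)), Hex.
      * intros t Ht. apply Rmult_le_compat_r; [left; apply exp_pos|].
        pose proof (sqrt_pos t). pose proof (sqrt_sqrt t ltac:(lra)). nra.
    + unfold minus, plus, opp; simpl. rewrite Ropp_0, exp_0.
      assert (0 <= (2 + x) * exp (- x)) by (apply Rmult_le_pos; [lra|left; apply exp_pos]).
      lra.
  - exists L. split.
    + apply Rlt_le_trans with (2 := HL1). apply RInt_gt_0; [lra| |intros; apply Hc].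
      intros t Ht. apply Rmult_lt_0_compat; [apply sqrt_lt_R0; lra|apply exp_pos].
    + apply is_RInt_gen_ext with f.
      * apply filter_imp with (2 := positive_ends
          (fun t => f t = Rpower t (1 / 2) * exp (- t))
          (fun t Ht => f_equal (fun r => r * exp (- t))
             (eq_sym (eq_trans (f_equal (Rpower t) (Rmult_1_l (/ 2))) (Rpower_sqrt t Ht))))).
        intros ab Hab x Hx. apply Hab. lra.
      * replace L with (L - 0) by ring.
        apply is_RInt_gen_primitive with F; [intros; apply HF|intros; apply Hc| |exact HL].
        intros P HP. apply filter_le_within.
        assert (HF0 : continuous F 0)
          by (apply (ex_derive_continuous (V := R_NormedModule)); eexists; apply HF).
        apply HF0. unfold F at 1. now rewrite RInt_point.
Qed.

Lemma Rpower_exp_as_exp (z t : R) : Rpower t z * exp (- t) = exp (z * ln t - t).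
Proof. unfold Rpower. rewrite <- exp_plus. f_equal. Qed.

Lemma exp_to_0 {T} (D : (T -> Prop) -> Prop) {FD : Filter D} (h : T -> R) :
  (forall M, D (fun t => h t < M)) -> filterlim (fun t => exp (h t)) D (locally 0).
Proof.
  intros Hh. apply filterlim_comp with (G := Rbar_locally m_infty).
  - intros P [M HM]. apply filter_imp with (2 := Hh M). auto.
  - apply is_lim_exp_m.
Qed.

Lemma Rpower_exp_lim_0 (z : R) : 0 < z ->
  filterlim (fun t => Rpower t z * exp (- t)) (at_right 0) (locally 0).
Proof.
  intros Hz. apply filterlim_ext with (fun t => exp (z * ln t - t)).
  { intros t. symmetry. apply Rpower_exp_as_exp. }
  apply exp_to_0; [typeclasses eauto|]. intros M.
  assert (A : at_right 0 (fun t => ln t < M / z)).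
  { exact (is_lim_ln_0 (fun y => y < M / z) (ex_intro _ (M / z) (fun y H => H))). }
  assert (B : at_right 0 (fun t => 0 < t)).
  { exists (mkposreal 1 Rlt_0_1). intros y _ Hy. exact Hy. }
  apply filter_imp with (2 := filter_and _ _ A B). intros t [Ht Ht0].
  assert (z * ln t < z * (M / z)) by (apply Rmult_lt_compat_l; lra).
  replace (z * (M / z)) with M in H by (field; lra). lra.
Qed.

Lemma Rpower_exp_lim_p_infty (z : R) : 0 < z ->
  filterlim (fun t => Rpower t z * exp (- t)) (Rbar_locally p_infty) (locally 0).
Proof.
  intros Hz. apply filterlim_ext with (fun t => exp (z * ln t - t)).
  { intros t. symmetry. apply Rpower_exp_as_exp. }
  apply exp_to_0; [typeclasses eauto|]. intros M.
  assert (He : 0 < / (2 * z)) by (apply Rinv_0_lt_compat; lra).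
  assert (A : Rbar_locally p_infty (fun t => ln t / t < / (2 * z))).
  { pose proof is_lim_div_ln_p as H. apply is_lim_spec in H.
    specialize (H (mkposreal _ He)). apply filter_imp with (2 := H).
    intros t Ht. simpl in Ht. apply Rabs_def2 in Ht. lra. }
  assert (B : Rbar_locally p_infty (fun t => Rmax 1 (- 2 * M) < t)) by (eexists; eauto).
  apply filter_imp with (2 := filter_and _ _ A B). intros t [Ht Ht0].
  pose proof (Rmax_l 1 (- 2 * M)). pose proof (Rmax_r 1 (- 2 * M)).
  assert (z * t * (ln t / t) < z * t * / (2 * z))
    by (apply Rmult_lt_compat_l; [apply Rmult_lt_0_compat; lra|exact Ht]).
  replace (z * t * (ln t / t)) with (z * ln t) in H1 by (field; lra).
  replace (z * t * / (2 * z)) with (t / 2) in H1 by (field; lra). lra.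
Qed.

Lemma is_derive_Rpower_exp (z t : R) : 0 < t ->
  is_derive (fun t => Rpower t z * exp (- t)) t
    (z * (Rpower t (z - 1) * exp (- t)) - Rpower t z * exp (- t)).
Proof.
  intros Ht.
  apply is_derive_ext with (fun t => exp (z * ln t - t));
    [intros; symmetry; apply Rpower_exp_as_exp|].
  auto_derive; [exact Ht|].
  rewrite !Rpower_exp_as_exp.
  replace ((z - 1) * ln t - t) with ((z * ln t - t) + - ln t) by ring.
  rewrite (exp_plus (z * ln t - t) (- ln t)), (exp_Ropp (ln t)), exp_ln by exact Ht.
  replace (z * ln t + - t) with (z * ln t - t) by ring. field. lra.
Qed.

Lemma continuous_Rpower_exp (z t : R) : 0 < t ->
  continuous (fun t => Rpower t z * exp (- t)) t.
Proof.
  intros Ht. apply (ex_derive_continuous (V := R_NormedModule)).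
  eexists. now apply is_derive_Rpower_exp.
Qed.

(** The derivative of [t ^ z * exp (- t)] is a combination of the two integrands, and
    that function tends to zero at both ends. *)
Lemma Gamma_integral_step (z l : R) : 0 < z ->
  is_RInt_gen (fun t => Rpower t (z - 1) * exp (- t))
    (at_right 0) (Rbar_locally p_infty) l ->
  is_RInt_gen (fun t => Rpower t z * exp (- t))
    (at_right 0) (Rbar_locally p_infty) (z * l).
Proof.
  intros Hz Hl.
  assert (H0 : is_RInt_gen
    (fun t => z * (Rpower t (z - 1) * exp (- t)) - Rpower t z * exp (- t))
    (at_right 0) (Rbar_locally p_infty) (0 - 0)).
  { apply is_RInt_gen_primitive with (fun t => Rpower t z * exp (- t)).
    - intros t Ht. now apply is_derive_Rpower_exp.
    - intros t Ht. apply (continuous_minus (V := R_NormedModule));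
        [|now apply continuous_Rpower_exp].
      apply (continuous_scal_r z (fun t => Rpower t (z - 1) * exp (- t))).
      now apply continuous_Rpower_exp.
    - now apply Rpower_exp_lim_0.
    - now apply Rpower_exp_lim_p_infty. }
  pose proof (is_RInt_gen_minus _ _ _ _ (is_RInt_gen_scal _ z _ Hl) H0) as H.
  replace (z * l) with (minus (scal z l) (0 - 0))
    by (unfold minus, plus, opp, scal; simpl; unfold mult; simpl; ring).
  apply is_RInt_gen_ext with (2 := H). apply filter_forall. intros ab x _.
  unfold minus, plus, opp, scal; simpl; unfold mult; simpl; ring.
Qed.

(** The rising factorial of [3 / 2]. *)
Fixpoint rising (n : nat) : R :=
  match n with O => 1 | S m => rising m * (INR m + 3 / 2) end.

Lemma rising_pos (n : nat) : 0 < rising n.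
Proof.
  induction n as [|n IH]; simpl; [lra|].
  apply Rmult_lt_0_compat; [exact IH|]. pose proof (pos_INR n). lra.
Qed.

Lemma EulerGamma_half_integer :
  exists g, 0 < g /\ forall i, EulerGamma (INR i + 3 / 2) = g * rising i.
Proof.
  destruct Gamma_three_half_integral as [g [Hg Hint]]. exists g. split; [exact Hg|].
  intros i. unfold EulerGamma.
  assert (Hi : is_RInt_gen (fun t => Rpower t (INR i + 3 / 2 - 1) * exp (- t))
                 (at_right 0) (Rbar_locally p_infty) (g * rising i)).
  { induction i as [|i IH].
    - simpl. rewrite Rmult_1_r. replace (0 + 3 / 2 - 1) with (1 / 2) by field. exact Hint.
    - replace (INR (S i) + 3 / 2 - 1) with (INR i + 3 / 2) by (rewrite S_INR; ring).
      replace (g * rising (S i)) with ((INR i + 3 / 2) * (g * rising i))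
        by (simpl; ring).
      apply Gamma_integral_step; [|exact IH]. pose proof (pos_INR i). lra. }
  apply (is_RInt_gen_unique (V := R_CompleteNormedModule)). exact Hi.
Qed.

(** * The eigenfunctions in closed form *)

Definition binom (N r : nat) : R := if (r <=? N)%nat then Binomial.C N r else 0.

Lemma binom_le (N r : nat) : (r <= N)%nat -> binom N r = Binomial.C N r.
Proof. intros H. unfold binom. now rewrite (proj2 (Nat.leb_le _ _) H). Qed.

Lemma binom_gt (N r : nat) : (N < r)%nat -> binom N r = 0.
Proof. intros H. unfold binom. now rewrite (proj2 (Nat.leb_gt _ _) H). Qed.

Lemma binom_pascal (N r : nat) : binom (S N) (S r) = binom N r + binom N (S r).
Proof.
  destruct (lt_eq_lt_dec r N) as [[H|H]|H].
  - rewrite !binom_le by lia. symmetry. now apply pascal.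
  - subst. rewrite (binom_gt N (S N)), !binom_le, !C_n_n by lia. ring.
  - rewrite !binom_gt by lia. ring.
Qed.

Lemma binom_absorb (N r : nat) :
  (INR (S N) - INR r) * binom (S N) r = INR (S N) * binom N r.
Proof.
  destruct (lt_eq_lt_dec r (S N)) as [[H|H]|H].
  - rewrite !binom_le by lia. rewrite pascal_step2 by lia.
    rewrite minus_INR by lia. field.
    assert (INR r < INR (S N)) by (apply lt_INR; lia). lra.
  - subst. rewrite (binom_gt N) by lia. ring.
  - rewrite !binom_gt by lia. ring.
Qed.

Lemma sum_n_shift (f : nat -> R) (M : nat) :
  sum_n f (S M) = f O + sum_n (fun r => f (S r)) M.
Proof.
  induction M as [|M IH].
  - rewrite sum_Sn, !sum_O. reflexivity.
  - rewrite sum_Sn, IH, (sum_Sn _ M). unfold plus; simpl. ring.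
Qed.

Lemma sum_n_linear (f g h : nat -> R) (a c : R) (M : nat) :
  (forall r, (r <= M)%nat -> h r = a * f r + c * g r) ->
  sum_n h M = a * sum_n f M + c * sum_n g M.
Proof.
  induction M as [|M IH]; intros E.
  - rewrite !sum_O. now apply E.
  - rewrite !sum_Sn, IH, E by auto. unfold plus; simpl. ring.
Qed.

(** The sine and cosine of [r * PI / 2], that is, the imaginary and real parts of
    the [r]-th power of the imaginary unit. *)
Fixpoint quadrant (b : bool) (r : nat) : R :=
  match r with
  | O => if b then 1 else 0
  | S r => if b then - quadrant false r else quadrant true r
  end.

Definition multiple_term (b : bool) (x : R) (N r : nat) : R :=
  binom N r * quadrant b r * sin x ^ r * cos x ^ (N - r).

Lemma multiple_term_pascal (b : bool) (x : R) (N r : nat) :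
  multiple_term b x (S N) (S r) =
  (if b then -1 else 1) * sin x * multiple_term (negb b) x N r
  + cos x * multiple_term b x N (S r).
Proof.
  unfold multiple_term. rewrite binom_pascal, Nat.sub_succ.
  destruct (le_lt_dec (S r) N) as [H|H].
  - replace (N - r)%nat with (S (N - S r)) by lia.
    destruct b; simpl; ring.
  - rewrite (binom_gt N (S r)) by lia. destruct b; simpl; ring.
Qed.

(** De Moivre's formula, split into real and imaginary parts. *)
Lemma multiple_angle (x : R) (N : nat) : forall (b : bool) (M : nat), (N <= M)%nat ->
  wave b (INR N * x) = sum_n (multiple_term b x N) M.
Proof.
  induction N as [|N IH]; intros b M HM.
  - simpl INR. rewrite Rmult_0_l.
    assert (E : sum_n (multiple_term b x 0) M = multiple_term b x 0 0).
    { clear HM. induction M as [|M IHM]; [now rewrite sum_O|].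
      rewrite sum_Sn, IHM. unfold multiple_term at 2. rewrite (binom_gt 0) by lia.
      unfold plus; simpl; ring. }
    rewrite E. unfold multiple_term. rewrite binom_le, C_n_0 by lia.
    destruct b; simpl; rewrite ?cos_0, ?sin_0; ring.
  - destruct M as [|M]; [lia|].
    rewrite sum_n_shift,
      (sum_n_linear _ _ _ _ _ M (fun r _ => multiple_term_pascal b x N r)).
    rewrite <- (IH (negb b) M) by lia.
    pose proof (sum_n_shift (multiple_term b x N) M) as E.
    rewrite <- (IH b (S M)) in E by lia.
    assert (E0 : multiple_term b x (S N) 0 = cos x * multiple_term b x N 0).
    { unfold multiple_term. rewrite !binom_le, !C_n_0, !Nat.sub_0_r by lia.
      destruct b; simpl; ring. }
    rewrite E0, S_INR, Rmult_plus_distr_r, Rmult_1_l.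
    replace (sum_n (fun r => multiple_term b x N (S r)) M)
      with (wave b (INR N * x) - multiple_term b x N 0) by lra.
    destruct b; simpl; [rewrite cos_plus|rewrite sin_plus]; ring.
Qed.

Lemma quadrant_false (s : nat) :
  quadrant false (2 * s) = 0 /\ quadrant false (2 * s + 1) = (-1) ^ s.
Proof.
  induction s as [|s [IH1 IH2]]; [split; reflexivity|].
  replace (2 * S s)%nat with (S (S (2 * s))) by lia.
  replace (S (S (2 * s)) + 1)%nat with (S (S (2 * s + 1))) by lia.
  assert (Q : forall r, quadrant false (S (S r)) = - quadrant false r) by reflexivity.
  rewrite !Q, IH1, IH2. simpl. split; ring.
Qed.

Lemma sin_multiple_angle (x : R) (N m : nat) : (N <= 2 * m + 1)%nat ->
  sin (INR N * x) =
  sum_n (fun s => binom N (2 * s + 1) * (-1) ^ s * sin x ^ (2 * s + 1)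
                  * cos x ^ (N - (2 * s + 1))) m.
Proof.
  intros H. change (sin (INR N * x)) with (wave false (INR N * x)).
  rewrite (multiple_angle x N false (2 * m + 1) H). clear H.
  assert (E : forall s, multiple_term false x N (2 * s) = 0 /\
    multiple_term false x N (2 * s + 1) =
    binom N (2 * s + 1) * (-1) ^ s * sin x ^ (2 * s + 1) * cos x ^ (N - (2 * s + 1))).
  { intros s. destruct (quadrant_false s) as [E1 E2]. unfold multiple_term.
    rewrite E1, E2. split; ring. }
  induction m as [|m IH].
  - change (2 * 0 + 1)%nat with 1%nat. rewrite sum_Sn, !sum_O.
    destruct (E 0%nat) as [E1 E2]. rewrite <- E2. change (2 * 0)%nat with 0%nat in E1.
    rewrite E1. unfold plus; simpl. ring.
  - replace (2 * S m + 1)%nat with (S (S (2 * m + 1))) by lia.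
    rewrite !sum_Sn, IH. destruct (E (S m)) as [E1 E2]. rewrite <- E2.
    replace (S (2 * m + 1)) with (2 * S m)%nat by lia.
    replace (S (2 * S m)) with (2 * S m + 1)%nat by lia.
    rewrite E1. unfold plus; simpl. ring.
Qed.

(** Both falling factorials at half-integers are quotients of rising factorials of
    [3 / 2], which [rising_fact] turns into factorials of odd numbers. *)
Lemma gbinom_half (n m : nat) : (m <= n)%nat ->
  gbinom (INR n + 1 / 2) m * INR (fact m) * rising (n - m) = rising n.
Proof.
  induction m as [|m IH]; intros H.
  - simpl. rewrite Nat.sub_0_r. ring.
  - rewrite <- IH by lia. replace (n - m)%nat with (S (n - S m)) by lia.
    rewrite fact_simpl, mult_INR. cbn [gbinom rising].
    rewrite minus_INR by lia.
    rewrite S_INR. pose proof (pos_INR m). field. lra.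
Qed.

Lemma rising_fact (n : nat) :
  rising n * INR (fact n) * 4 ^ n = INR (fact (2 * n + 1)).
Proof.
  induction n as [|n IH]; [simpl; ring|].
  replace (2 * S n + 1)%nat with (S (S (2 * n + 1))) by lia.
  rewrite !fact_simpl, !mult_INR, <- IH. cbn [rising].
  rewrite !S_INR, plus_INR, mult_INR. simpl. field.
Qed.

(** The coefficients of the Jacobi polynomial with parameters [1/2, 3/2] are
    binomial coefficients of the even number [2 * n + 4] up to a linear factor. *)
Lemma jacobi_coefficient (n s : nat) : (s <= n)%nat ->
  gbinom (INR n + 1 / 2) (n - s) * gbinom (INR n + 3 / 2) s =
  rising n / (2 * INR (fact (n + 1)) * (2 * INR n + 4))
  * ((2 * INR (n - s) + 2) * binom (2 * n + 4) (2 * s + 1)).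
Proof.
  intros Hs.
  pose proof (gbinom_half n (n - s) ltac:(lia)) as G1.
  replace (n - (n - s))%nat with s in G1 by lia.
  pose proof (gbinom_half (n + 1) s ltac:(lia)) as G2.
  replace (INR (n + 1) + 1 / 2) with (INR n + 3 / 2) in G2
    by (rewrite plus_INR; simpl; field).
  pose proof (rising_fact s) as F1.
  pose proof (rising_fact (n + 1 - s)) as F2.
  pose proof (rising_fact (n + 1)) as F3.
  assert (Hb : binom (2 * n + 4) (2 * s + 1) =
    INR (fact (2 * n + 4)) / (INR (fact (2 * s + 1)) * INR (fact (2 * (n + 1 - s) + 1)))).
  { rewrite binom_le by lia. unfold Binomial.C. do 3 f_equal. f_equal. lia. }
  rewrite Hb, <- F1, <- F2. replace (2 * n + 4)%nat with (S (2 * (n + 1) + 1)) by lia.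
  rewrite fact_simpl, mult_INR, <- F3.
  replace (n + 1 - s)%nat with (S (n - s)) in * by lia.
  rewrite (fact_simpl (n - s)), mult_INR.
  assert (Hp : 4 ^ (n + 1) = 4 ^ s * 4 ^ S (n - s))
    by (rewrite <- pow_add; f_equal; lia).
  rewrite Hp, <- G2.
  assert (E1 : gbinom (INR n + 1 / 2) (n - s) =
    rising n / (INR (fact (n - s)) * rising s)).
  { rewrite <- G1. field. split; [|apply INR_fact_neq_0].
    apply Rgt_not_eq, rising_pos. }
  rewrite E1. rewrite !S_INR, !plus_INR, !mult_INR, plus_INR.
  pose proof (pos_INR (n - s)). pose proof (pos_INR n). simpl INR.
  field.
  repeat split; try apply INR_fact_neq_0; try (apply Rgt_not_eq, rising_pos);
    try (apply pow_nonzero; lra); try lra.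
Qed.

(** The linear factor in the coefficients is absorbed by passing from
    [sin ((2 n + 4) x)] to [(2 n + 4) cos x * sin ((2 n + 3) x)]. *)
Lemma jacobi_closed_form (n : nat) (x : R) :
  sin x * (cos x ^ 3 * jacobi (1 / 2) (3 / 2) n (cos (2 * x))) =
  rising n / (2 * INR (fact (n + 1)) * (2 * INR n + 4))
  * (omega n * cos x * sin (omega n * x) - sin x * cos (omega n * x)).
Proof.
  set (A := rising n / (2 * INR (fact (n + 1)) * (2 * INR n + 4))).
  set (N := (2 * n + 3)%nat).
  assert (HN : INR N = omega n) by (unfold N, omega; rewrite plus_INR, mult_INR; simpl; ring).
  (* The last two of the [n + 3] terms of the expansions cancel in the combination. *)
  set (c := fun s => (INR (S N) - INR (2 * s + 1) - 1) * binom (S N) (2 * s + 1)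
      * (-1) ^ s * sin x ^ (2 * s + 1) * cos x ^ (S N - (2 * s + 1))).
  assert (E1 : omega n * cos x * sin (omega n * x) - sin x * cos (omega n * x)
               = sum_n c (n + 2)).
  { transitivity (INR (S N) * cos x * sin (INR N * x) + (-1) * sin (INR (S N) * x)).
    - rewrite S_INR, HN. replace ((omega n + 1) * x) with (omega n * x + x) by ring.
      rewrite sin_plus. ring.
    - rewrite (sin_multiple_angle x N (n + 2)), (sin_multiple_angle x (S N) (n + 2))
        by (unfold N; lia).
      symmetry. apply sum_n_linear. intros s _. unfold c.
      replace ((INR (S N) - INR (2 * s + 1) - 1) * binom (S N) (2 * s + 1))
        with (INR (S N) * binom N (2 * s + 1) - binom (S N) (2 * s + 1))
        by (rewrite <- binom_absorb; ring).
      destruct (le_lt_dec (2 * s + 1) N) as [H|H].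
      + replace (S N - (2 * s + 1))%nat with (S (N - (2 * s + 1))) by lia. simpl pow. ring.
      + rewrite (binom_gt N) by exact H. ring. }
  assert (E2 : sum_n c (n + 2) = sum_n c n).
  { replace (n + 2)%nat with (S (S n)) by lia. rewrite !sum_Sn.
    assert (c (S n) = 0).
    { unfold c. replace (INR (S N) - INR (2 * S n + 1) - 1) with 0; [ring|].
      replace (S N) with (2 * S n + 1 + 1)%nat by (unfold N; lia).
      rewrite (plus_INR _ 1). simpl INR at 2. ring. }
    assert (c (S (S n)) = 0).
    { unfold c, N. rewrite binom_gt by lia. ring. }
    rewrite H, H0. unfold plus; simpl. ring. }
  rewrite E1, E2. unfold jacobi. rewrite <- Rmult_assoc.
  transitivity (sum_n (fun s => A * c s) n);
    [|rewrite (sum_n_linear c c _ A 0 n) by (intros; ring); ring].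
  match goal with |- _ = sum_n ?h _ =>
    match goal with |- _ * sum_n ?f _ = _ =>
      rewrite (sum_n_linear f c h (sin x * cos x ^ 3) 0 n); [ring|] end end.
  intros s Hs. cbv beta. rewrite Rmult_0_l, Rplus_0_r. symmetry.
  rewrite (jacobi_coefficient n s Hs). fold A.
  replace (2 * n + 4)%nat with (S N) by (unfold N; lia). unfold c.
  replace ((cos (2 * x) - 1) / 2) with ((-1) * sin x ^ 2)
    by (rewrite cos_2a_sin; simpl; field).
  replace ((cos (2 * x) + 1) / 2) with (cos x ^ 2)
    by (rewrite cos_2a_cos; simpl; field).
  replace (S N - (2 * s + 1))%nat with (3 + 2 * (n - s))%nat by (unfold N; lia).
  replace (INR (S N) - INR (2 * s + 1) - 1) with (2 * INR (n - s) + 2).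
  2:{ unfold N. rewrite S_INR, !plus_INR, !mult_INR, minus_INR by lia. simpl. ring. }
  rewrite Rpow_mult_distr, !pow_add, !pow_mult, pow_1. ring.
Qed.

Definition amplitude (i : nat) : R :=
  sqrt (INR (fact i) * INR (fact (i + 2))) * (rising i / EulerGamma (INR i + 3 / 2))
  / (INR (fact (i + 1)) * (2 * INR i + 4)).

Lemma e_closed_form (i : nat) (x : R) :
  sin x * e i x =
  amplitude i * (omega i * cos x * sin (omega i * x) - sin x * cos (omega i * x)).
Proof.
  unfold e, amplitude.
  pose proof (jacobi_closed_form i x) as J.
  transitivity (2 * (sqrt (INR (fact i) * INR (fact (i + 2))) / EulerGamma (INR i + 3 / 2)) *
    (sin x * (cos x ^ 3 * jacobi (1 / 2) (3 / 2) i (cos (2 * x))))); [ring|].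
  rewrite J. pose proof (INR_fact_neq_0 (i + 1)). pose proof (pos_INR i).
  unfold Rdiv. set (ig := / EulerGamma _). field. split; [lra|assumption].
Qed.

(** The Gamma function grows like the rising factorial, so that what is left of the
    normalization is of order [1 / omega i]. *)
Lemma amplitude_bound : exists C, forall i, Rabs (amplitude i * omega i) <= C.
Proof.
  destruct EulerGamma_half_integer as [g [Hg HG]]. exists (2 / g).
  intros i. pose proof (rising_pos i) as Hr. pose proof (pos_INR i) as Hi.
  assert (Hf : forall i, 0 < INR (fact i)) by (intros; apply INR_fact_lt_0).
  unfold amplitude. rewrite HG.
  set (S0 := sqrt (INR (fact i) * INR (fact (i + 2)))).
  assert (Hs : 0 <= S0 <= 2 * INR (fact (i + 1))).
  { split; [apply sqrt_pos|].
    apply Rsqr_incr_0; [|apply sqrt_pos|pose proof (Hf (i + 1)%nat); lra].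
    unfold S0. rewrite Rsqr_sqrt by (left; now apply Rmult_lt_0_compat).
    replace (i + 2)%nat with (S (S i)) by lia. replace (i + 1)%nat with (S i) by lia.
    rewrite !fact_simpl, !mult_INR, !S_INR. unfold Rsqr.
    pose proof (Hf i). set (f := INR (fact i)) in *. set (t := INR i) in *.
    replace (f * ((t + 1 + 1) * ((t + 1) * f))) with (f * f * ((t + 2) * (t + 1))) by ring.
    replace (2 * ((t + 1) * f) * (2 * ((t + 1) * f)))
      with (f * f * (4 * (t + 1) * (t + 1))) by ring.
    apply Rmult_le_compat_l; nra. }
  pose proof (Hf (i + 1)%nat) as Hf1. set (F := INR (fact (i + 1))) in *.
  replace (S0 * (rising i / (g * rising i)) / (F * (2 * INR i + 4)) * omega i)
    with (S0 * omega i / (g * F * (2 * INR i + 4))) by (field; lra).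
  pose proof (omega_ge_3 i).
  assert (Hd : 0 < g * F * (2 * INR i + 4)) by (repeat apply Rmult_lt_0_compat; lra).
  rewrite Rabs_pos_eq.
  - apply Rmult_le_reg_r with (g * F * (2 * INR i + 4)); [exact Hd|].
    replace (S0 * omega i / (g * F * (2 * INR i + 4)) * (g * F * (2 * INR i + 4)))
      with (S0 * omega i) by (field; lra).
    replace (2 / g * (g * F * (2 * INR i + 4))) with (2 * F * (2 * INR i + 4)) by (field; lra).
    apply Rmult_le_compat; [lra|lra|lra|unfold omega; lra].
  - apply Rmult_le_pos; [apply Rmult_le_pos; lra|]. left; now apply Rinv_0_lt_compat.
Qed.

Lemma e_0_closed_form (x : R) : e 0 x = e 0 0 * cos x ^ 3.
Proof. unfold e, jacobi. rewrite !sum_O. simpl. rewrite cos_0. ring. Qed.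

Lemma e_0_0_neq_0 : e 0 0 <> 0.
Proof.
  destruct EulerGamma_half_integer as [g [Hg HG]].
  unfold e, jacobi. rewrite HG, sum_O, cos_0. simpl.
  pose proof (sqrt_lt_R0 (1 * (1 + 1)) ltac:(lra)).
  apply Rgt_not_eq. rewrite !Rmult_1_r. apply Rmult_lt_0_compat; [lra|].
  now apply Rdiv_lt_0_compat.
Qed.

(** * Integrals of two eigenfunctions against a weight *)

Lemma sin_cos_pos (x : R) : 0 < x < PI / 2 -> 0 < sin x /\ 0 < cos x.
Proof.
  intros Hx. pose proof PI_RGT_0. split; [apply sin_gt_0|apply cos_gt_0]; lra.
Qed.

Lemma e_interior (i : nat) (x : R) : 0 < x < PI ->
  e i x = amplitude i * (omega i * cos x / sin x * sin (omega i * x) - cos (omega i * x)).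
Proof.
  intros Hx. pose proof (sin_pos x Hx) as Hs.
  apply Rmult_eq_reg_l with (sin x); [|lra]. rewrite e_closed_form. field. lra.
Qed.

Lemma de_interior (i : nat) (x : R) : 0 < x < PI ->
  de i x = amplitude i * omega i *
    (omega i * cos x / sin x * cos (omega i * x) - (cos x / sin x) ^ 2 * sin (omega i * x)).
Proof.
  intros Hx. pose proof (sin_pos x Hx) as Hs. unfold de.
  rewrite (Derive_ext_loc _ (fun x => amplitude i *
    (omega i * cos x / sin x * sin (omega i * x) - cos (omega i * x)))).
  - apply is_derive_unique. auto_derive; [lra|].
    field. lra.
  - apply (locally_open_interval 0 PI); [exact Hx|]. intros y Hy. now apply e_interior.
Qed.

Lemma weight_sin_cos n B H : weight 1 1 n B H ->
  weight (parity false) (parity false) (S n) (fun x => sin x * (cos x * B x))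
    (fun x => sin x * - H x).
Proof. intros HB. simpl. now apply weight_mul_sin, weight_mul_cos. Qed.

Lemma weight_sin_sin n B H : weight 1 1 n B H ->
  weight 1 1 n (fun x => sin x * (sin x * B x)) (fun x => sin x * (sin x * H x)).
Proof.
  intros HB. rewrite <- (Ropp_involutive 1) at 1. now apply weight_mul_sin, weight_mul_sin.
Qed.

Lemma weight_cos_cos n B H : weight 1 1 n B H ->
  weight 1 1 (S (S n)) (fun x => cos x * (cos x * B x)) (fun x => - - H x).
Proof.
  intros HB. rewrite <- (Ropp_involutive 1) at 2. now apply weight_mul_cos, weight_mul_cos.
Qed.

Definition weight_sin2_cos2 n B H (HB : weight 1 1 n B H) :=
  weight_sin_sin _ _ _ (weight_cos_cos n B H HB).

Lemma weight_cos_double n sg tau B H : weight sg tau n B H ->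
  weight sg tau n (fun x => cos (2 * x) * B x) (fun x => 1 * cos (2 * x) * H x).
Proof.
  intros HB. rewrite <- (Rmult_1_l sg), <- (Rmult_1_l tau).
  apply weight_mul; [apply smooth_cos_lin| | |exact HB].
  - intros x. replace (2 * - x) with (- (2 * x)) by ring. rewrite cos_neg. ring.
  - intros x. replace (2 * (PI - x)) with (- (2 * x) + 2 * INR 1 * PI) by (simpl; ring).
    rewrite cos_period, cos_neg. ring.
Qed.

Lemma amplitudes_bound :
  exists C, forall i j, Rabs (amplitude i * omega i * (amplitude j * omega j)) <= C.
Proof.
  destruct amplitude_bound as [C HC]. exists (C * C). intros i j. rewrite Rabs_mult.
  apply Rmult_le_compat; auto using Rabs_pos.
Qed.

(** In [tan * e i] the part carrying [tan x * cos (omega i * x)] is smaller by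
    [1 / omega i] but its weight loses a zero at [PI / 2]. For the larger of the
    two frequencies the factor makes up for the lost power of the gap; for the
    smaller one the cancellation between the sum and the difference does. *)
Lemma decay_eigen n F B H :
  weight 1 1 n B H -> (forall x, 0 < x < PI / 2 -> F x = cos x ^ 2 * B x) ->
  decay (n + 3) (fun i j => quarter (fun x => F x * (e i x * e j x * tan x ^ 2))).
Proof.
  intros HB HF. pose proof (weight_smooth _ _ _ _ _ HB) as HS.
  pose proof (weight_cos_cos _ _ _ HB) as W0.
  pose proof (weight_sin_cos _ _ _ HB) as W1.
  pose proof (weight_sin_sin _ _ _ HB) as W2.
  destruct amplitudes_bound as [C HC].
  pose (X := fun i j =>
    mixed false false (fun x => cos x * (cos x * B x)) i j
    + (-1) * (/ omega j * mixed false true (fun x => sin x * (cos x * B x)) i j)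
    + (-1) * (/ omega i * mixed true false (fun x => sin x * (cos x * B x)) i j)
    + / omega i * (/ omega j * mixed true true (fun x => sin x * (sin x * B x)) i j)).
  apply decay_ext with (fun i j => amplitude i * omega i * (amplitude j * omega j) * X i j).
  - intros i j. unfold X, mixed.
    rewrite <- !quarter_scal, <- !quarter_plus by smooth_auto.
    rewrite <- quarter_scal by smooth_auto.
    apply quarter_ext. intros x Hx. destruct (sin_cos_pos x Hx) as [Hs Hc].
    pose proof (omega_ge_3 i). pose proof (omega_ge_3 j). pose proof PI_RGT_0.
    rewrite HF by exact Hx. rewrite !e_interior by lra. unfold tan, wave.
    field. lra.
  - apply decay_mul with C; [exact HC|]. unfold X.
    replace (n + 3)%nat with (S (S (S n))) by lia.
    repeat apply decay_plus.
    + now apply (decay_mixed false false) with (1 := W0).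
    + apply decay_mul with 1; [intros; rewrite Rabs_left; lra|].
      now apply (decay_mixed_cancel false) with (1 := W1).
    + apply decay_mul with 1; [intros; rewrite Rabs_left; lra|].
      apply decay_div_fst. now apply (decay_mixed true false) with (1 := W1).
    + apply decay_div_fst. now apply (decay_mixed_cancel true) with (1 := W2).
Qed.

(** For the derivatives the correction terms carry a cotangent, which adds a zero at
    [PI / 2] instead of removing one; the price is a double zero at the origin. *)
Lemma decay_eigen_derivative n F B H :
  weight 1 1 n B H -> (forall x, 0 < x < PI / 2 -> F x = sin x ^ 2 * B x) ->
  decay (n + 1) (fun i j => quarter (fun x =>
    F x * (de i x / omega i * (de j x / omega j) * tan x ^ 2))).
Proof.
  intros HB HF. pose proof (weight_smooth _ _ _ _ _ HB) as HS.
  pose proof (weight_cos_cos _ _ _ HB) as W0.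
  pose proof (weight_sin_cos _ _ _ HB) as W1.
  pose proof (weight_sin_sin _ _ _ HB) as W2.
  destruct amplitudes_bound as [C HC].
  pose (X := fun i j =>
    mixed true true (fun x => sin x * (sin x * B x)) i j
    + (-1) * (/ omega j * mixed true false (fun x => sin x * (cos x * B x)) i j)
    + (-1) * (/ omega i * mixed false true (fun x => sin x * (cos x * B x)) i j)
    + / omega i * (/ omega j * mixed false false (fun x => cos x * (cos x * B x)) i j)).
  apply decay_ext with (fun i j => amplitude i * omega i * (amplitude j * omega j) * X i j).
  - intros i j. unfold X, mixed.
    rewrite <- !quarter_scal, <- !quarter_plus by smooth_auto.
    rewrite <- quarter_scal by smooth_auto.
    apply quarter_ext. intros x Hx. destruct (sin_cos_pos x Hx) as [Hs Hc].
    pose proof (omega_ge_3 i). pose proof (omega_ge_3 j). pose proof PI_RGT_0.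
    rewrite HF by exact Hx. rewrite !de_interior by lra. unfold tan, wave.
    field. lra.
  - apply decay_mul with C; [exact HC|]. unfold X.
    repeat apply decay_plus.
    + apply decay_weaken with (S n); [lia|].
      now apply (decay_mixed true true) with (1 := W2).
    + apply decay_mul with 1; [intros; rewrite Rabs_left; lra|].
      apply decay_weaken with (S (S n)); [lia|]. apply decay_div_snd.
      now apply (decay_mixed true false) with (1 := W1).
    + apply decay_mul with 1; [intros; rewrite Rabs_left; lra|].
      apply decay_weaken with (S (S (S n))); [lia|]. apply decay_div_fst.
      now apply (decay_mixed false true) with (1 := W1).
    + apply decay_weaken with (S (S (S (S n)))); [lia|]. apply decay_div_fst, decay_div_snd.
      now apply (decay_mixed false false) with (1 := W0).
Qed.

Lemma cos_omega_PI2 (i : nat) : cos (omega i * (PI / 2)) = 0.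
Proof.
  replace (omega i * (PI / 2)) with (INR (i + 1) * PI + PI / 2)
    by (unfold omega; rewrite plus_INR; simpl; field).
  rewrite cos_plus, cos_PI2, sin_PI2, sin_mPI. ring.
Qed.

Lemma eigen_primitive (i : nat) (x : R) : 0 < x < PI / 2 ->
  RInt (fun y => e i y * sin y * cos y) x (PI / 2) =
  amplitude i * (cos x ^ 2 * cos (omega i * x)
    + 3 / (omega i ^ 2 - 4) * (omega i * sin x * cos x * sin (omega i * x)
                               + cos (2 * x) * cos (omega i * x))).
Proof.
  intros Hx. pose proof PI_RGT_0. pose proof (omega_ge_3 i) as Hi.
  set (P := fun x => amplitude i * (cos x ^ 2 * cos (omega i * x)
    + 3 / (omega i ^ 2 - 4) * (omega i * sin x * cos x * sin (omega i * x)
                               + cos (2 * x) * cos (omega i * x)))).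
  change (RInt (fun y => e i y * sin y * cos y) x (PI / 2) = P x).
  assert (HP : P (PI / 2) = 0).
  { unfold P. rewrite cos_omega_PI2, cos_PI2. ring. }
  assert (Hq : omega i ^ 2 - 4 <> 0) by nra.
  apply is_RInt_unique.
  apply is_RInt_ext with (fun y => amplitude i * (omega i * cos y ^ 2 * sin (omega i * y)
     - sin y * cos y * cos (omega i * y))).
  - intros y _. real_eq. transitivity (sin y * e i y * cos y); [|ring].
    rewrite e_closed_form. ring.
  - replace (P x) with (minus (- P (PI / 2)) (- P x))
      by (rewrite HP; unfold minus, plus, opp; simpl; ring).
    apply (is_RInt_derive (V := R_CompleteNormedModule) (fun y => - P y)).
    + intros y _. unfold P. auto_derive; [exact I|].
      rewrite (sin_2a y), (cos_2a_cos y).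
      field_simplify; [|nra]. rewrite sin_sq. field. exact Hq.
    + intros y _. apply (smooth_continuous (y - 1) (y + 1)); [smooth_auto|lra].
Qed.

(** The primitive of [e i * sin * cos] is [cos ^ 2 * cos (omega i * x)] up to terms
    with one or two factors [1 / omega i] more, each of which pays for one zero of the
    weight at [PI / 2]. So the weight needs two zeros less there than in
    [decay_eigen_derivative]. *)
Lemma decay_eigen_primitive n F B H :
  weight 1 1 n B H -> (forall x, 0 < x < PI / 2 -> F x = sin x ^ 2 * B x) ->
  decay (n + 3) (fun i j => omega i * quarter (fun x =>
    F x * (de j x / omega j * tan x * RInt (fun y => e i y * sin y * cos y) x (PI / 2)))).
Proof.
  intros HB HF. pose proof (weight_smooth _ _ _ _ _ HB) as HS.
  pose proof (weight_sin_sin _ _ _ HB) as W0.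
  pose proof (weight_cos_cos _ _ _ W0) as W1.
  pose proof (weight_sin_cos _ _ _ (weight_cos_cos _ _ _ HB)) as W2.
  pose proof (weight_sin_cos _ _ _ W0) as W3.
  pose proof (weight_cos_double _ _ _ _ _ W0) as W4.
  pose proof (weight_cos_double _ _ _ _ _ (weight_sin_cos _ _ _ HB)) as W5.
  cbv beta in *.
  destruct amplitudes_bound as [C HC].
  (* The factor [3 / (omega i ^ 2 - 4)] is [r i / omega i ^ 2] with [r] bounded. *)
  pose (r := fun i : nat => 3 * omega i ^ 2 / (omega i ^ 2 - 4)).
  assert (Hr : forall i, 0 <= r i <= 27 / 5).
  { intros i. pose proof (omega_ge_3 i). unfold r.
    assert (0 < omega i ^ 2 - 4) by nra. split.
    - apply Rmult_le_pos; [nra|]. left; now apply Rinv_0_lt_compat.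
    - apply Rmult_le_reg_r with (omega i ^ 2 - 4); [assumption|].
      unfold Rdiv. rewrite Rmult_assoc, Rinv_l, Rmult_1_r by lra. nra. }
  pose (X := fun i j =>
    mixed true true (fun x => cos x * (cos x * (sin x * (sin x * B x)))) i j
    + (-1) * (/ omega j *
        mixed true false (fun x => sin x * (cos x * (cos x * (cos x * B x)))) i j)
    + r i * (/ omega i *
        mixed false true (fun x => sin x * (cos x * (sin x * (sin x * B x)))) i j)
    + (- r i) * (/ omega i * (/ omega j *
        mixed false false (fun x => cos x * (cos x * (sin x * (sin x * B x)))) i j))
    + r i * (/ omega i * (/ omega i *
        mixed true true (fun x => cos (2 * x) * (sin x * (sin x * B x))) i j))
    + (- r i) * (/ omega i * (/ omega i * (/ omega j *
        mixed true false (fun x => cos (2 * x) * (sin x * (cos x * B x))) i j)))).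
  apply decay_ext with (fun i j => amplitude i * omega i * (amplitude j * omega j) * X i j).
  - intros i j. unfold X, mixed.
    rewrite <- !quarter_scal, <- !quarter_plus by smooth_auto.
    rewrite <- quarter_scal by smooth_auto.
    pose proof (omega_ge_3 i). pose proof (omega_ge_3 j). pose proof PI_RGT_0.
    set (Z := fun x : R => amplitude i * (amplitude j * omega j) * (B x *
        ((sin x ^ 2 * cos (omega j * x) - / omega j * (sin x * cos x) * sin (omega j * x))
         * (cos x ^ 2 * cos (omega i * x)
            + 3 / (omega i ^ 2 - 4) * (omega i * sin x * cos x * sin (omega i * x)
                               + cos (2 * x) * cos (omega i * x)))))).
    transitivity (quarter (fun x => omega i * Z x)).
    + apply quarter_ext. intros x Hx. destruct (sin_cos_pos x Hx) as [Hs Hc].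
      unfold Z, wave, r. field. repeat split; try lra; nra.
    + rewrite (quarter_scal (omega i) Z) by (unfold Z; smooth_auto).
      f_equal. apply quarter_ext. intros x Hx.
      destruct (sin_cos_pos x Hx) as [Hs Hc].
      rewrite eigen_primitive, HF by exact Hx. rewrite de_interior by lra. unfold Z, tan.
      field. repeat split; try lra; nra.
  - apply decay_mul with C; [exact HC|]. unfold X.
    replace (n + 3)%nat with (S (S (S n))) by lia.
    assert (Hr1 : forall i : nat, nat -> Rabs (r i) <= 27 / 5)
      by (intros i _; rewrite Rabs_pos_eq; apply Hr).
    assert (Hr2 : forall i : nat, nat -> Rabs (- r i) <= 27 / 5)
      by (intros; rewrite Rabs_Ropp; auto).
    repeat apply decay_plus.
    + now apply (decay_mixed true true) with (1 := W1).
    + apply decay_mul with 1; [intros; rewrite Rabs_left; lra|].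
      apply decay_weaken with (S (S (S (S n)))); [lia|]. apply decay_div_snd.
      now apply (decay_mixed true false) with (1 := W2).
    + apply decay_mul with (27 / 5); [exact Hr1|]. apply decay_div_fst.
      now apply (decay_mixed false true) with (1 := W3).
    + apply decay_mul with (27 / 5); [exact Hr2|].
      apply decay_weaken with (S (S (S (S n)))); [lia|]. apply decay_div_fst, decay_div_snd.
      now apply (decay_mixed false false) with (1 := W1).
    + apply decay_mul with (27 / 5); [exact Hr1|]. apply decay_div_fst, decay_div_fst.
      now apply (decay_mixed true true) with (1 := W4).
    + apply decay_mul with (27 / 5); [exact Hr2|].
      apply decay_weaken with (S (S (S (S n)))); [lia|].
      apply decay_div_fst, decay_div_fst, decay_div_snd.
      now apply (decay_mixed true false) with (1 := W5).
Qed.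

(** * Orthogonality *)

(** The quotient [cos ((2 n + 1) x) / cos x], written as a trigonometric polynomial to
    be smooth and bounded across the zeros of the cosine. *)
Fixpoint cos_quotient (n : nat) (x : R) : R :=
  match n with
  | O => 1
  | S m => 2 * cos (2 * INR n * x) - cos_quotient m x
  end.

Lemma cos_quotient_spec (n : nat) (x : R) :
  cos ((2 * INR n + 1) * x) = cos x * cos_quotient n x.
Proof.
  induction n as [|n IH].
  - simpl. rewrite Rmult_0_r, Rplus_0_l, Rmult_1_l. ring.
  - cbn [cos_quotient]. rewrite Rmult_minus_distr_l, <- IH.
    replace ((2 * INR (S n) + 1) * x) with (2 * INR (S n) * x + x) by ring.
    replace ((2 * INR n + 1) * x) with (2 * INR (S n) * x - x) by (rewrite S_INR; ring).
    rewrite cos_plus, cos_minus. ring.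
Qed.

Lemma cos_quotient_bound (n : nat) (x : R) : Rabs (cos_quotient n x) <= 2 * INR n + 1.
Proof.
  induction n as [|n IH].
  - simpl. rewrite Rabs_R1. lra.
  - cbn [cos_quotient]. unfold Rminus. eapply Rle_trans; [apply Rabs_triang|].
    rewrite Rabs_Ropp, Rabs_mult, (Rabs_pos_eq 2) by lra.
    assert (Hw : Rabs (cos (2 * INR (S n) * x)) <= 1) by apply (wave_le_1 true).
    pose proof (S_INR n) as HS. lra.
Qed.

Lemma cos_quotient_PI2 (n : nat) :
  cos_quotient n (PI / 2) = (2 * INR n + 1) * (-1) ^ n.
Proof.
  induction n as [|n IH]; [simpl; ring|].
  cbn [cos_quotient]. rewrite IH.
  replace (2 * INR (S n) * (PI / 2)) with (INR (S n) * PI) by field.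
  rewrite cos_mPI, S_INR. simpl. ring.
Qed.

Lemma smooth_cos_quotient (a b : R) (n : nat) : smooth a b (cos_quotient n).
Proof.
  induction n as [|n IH]; [exact (smooth_const a b 1)|].
  apply (smooth_minus a b (fun x => 2 * cos (2 * INR (S n) * x)) (cos_quotient n));
    [smooth_auto|exact IH].
Qed.

(** The extension of [tan * e i] through [PI / 2]. *)
Definition tan_e (i : nat) (x : R) : R :=
  amplitude i * (omega i * sin (omega i * x) - sin x * cos_quotient (i + 1) x).

Lemma cos_quotient_omega (i : nat) (x : R) :
  cos (omega i * x) = cos x * cos_quotient (i + 1) x.
Proof.
  rewrite <- cos_quotient_spec. f_equal. unfold omega. rewrite plus_INR. simpl. ring.
Qed.

Lemma smooth_tan_e (a b : R) (i : nat) : smooth a b (tan_e i).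
Proof.
  pose proof (smooth_cos_quotient a b (i + 1)). unfold tan_e. smooth_auto.
Qed.

Lemma tan_e_interior (i : nat) (x : R) : 0 < x < PI / 2 ->
  tan_e i x = amplitude i * (omega i * sin (omega i * x) - sin x / cos x * cos (omega i * x)).
Proof.
  intros Hx. destruct (sin_cos_pos x Hx). unfold tan_e.
  rewrite cos_quotient_omega. field. lra.
Qed.

Lemma tan_e_eq (i : nat) (x : R) : 0 < x < PI / 2 -> tan_e i x = tan x * e i x.
Proof.
  intros Hx. destruct (sin_cos_pos x Hx). rewrite tan_e_interior by exact Hx.
  rewrite e_interior by lra. unfold tan. field. lra.
Qed.

Lemma tan_e_0 (i : nat) : tan_e i 0 = 0.
Proof. unfold tan_e. rewrite Rmult_0_r, sin_0. ring. Qed.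

Lemma tan_e_PI2 (i : nat) : tan_e i (PI / 2) = 0.
Proof.
  unfold tan_e. rewrite cos_quotient_PI2, sin_PI2.
  replace (omega i * (PI / 2)) with (INR (i + 1) * PI + PI / 2)
    by (unfold omega; rewrite plus_INR; simpl; field).
  rewrite sin_plus, sin_PI2, cos_PI2, cos_mPI.
  unfold omega. rewrite plus_INR. simpl. ring.
Qed.

Lemma tan_e_bounded : exists C, 0 <= C /\ forall i x, Rabs (tan_e i x) <= C.
Proof.
  destruct amplitude_bound as [C HC].
  assert (HC0 : 0 <= C) by (eapply Rle_trans; [apply Rabs_pos|apply (HC 0%nat)]).
  exists (2 * C). split; [lra|]. intros i x. pose proof (omega_ge_3 i).
  assert (Hb : Rabs (omega i * sin (omega i * x) - sin x * cos_quotient (i + 1) x)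
               <= 2 * omega i).
  { unfold Rminus. eapply Rle_trans; [apply Rabs_triang|].
    rewrite Rabs_Ropp, !Rabs_mult, (Rabs_pos_eq (omega i)) by lra.
    assert (H1 : Rabs (sin (omega i * x)) <= 1) by apply (wave_le_1 false).
    assert (H2 : Rabs (sin x) <= 1) by apply (wave_le_1 false).
    pose proof (cos_quotient_bound (i + 1) x) as H3.
    replace (2 * INR (i + 1) + 1) with (omega i) in H3
      by (unfold omega; rewrite plus_INR; simpl; ring).
    assert (omega i * Rabs (sin (omega i * x)) <= omega i * 1)
      by (apply Rmult_le_compat_l; lra).
    assert (Rabs (sin x) * Rabs (cos_quotient (i + 1) x) <= 1 * omega i)
      by (apply Rmult_le_compat; auto using Rabs_pos).
    lra. }
  specialize (HC i). rewrite Rabs_mult, (Rabs_pos_eq (omega i)) in HC by lra.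
  unfold tan_e. rewrite Rabs_mult.
  apply Rle_trans with (Rabs (amplitude i) * (2 * omega i)); [|lra].
  apply Rmult_le_compat_l; [apply Rabs_pos|exact Hb].
Qed.

(** The eigenvalue equation, in Liouville normal form. *)
Lemma tan_e_ode (i : nat) (x : R) : 0 < x < PI / 2 ->
  Derive (Derive (tan_e i)) x = (2 / cos x ^ 2 - omega i ^ 2) * tan_e i x.
Proof.
  intros Hx. pose proof (sin_cos_pos x Hx) as [Hs Hc].
  assert (D1 : forall y, 0 < y < PI / 2 -> Derive (tan_e i) y =
    amplitude i * (omega i ^ 2 * cos (omega i * y) - cos (omega i * y) / cos y ^ 2
                   + omega i * (sin y / cos y) * sin (omega i * y))).
  { intros y Hy. pose proof (sin_cos_pos y Hy) as [Hs' Hc'].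
    rewrite (Derive_ext_loc _ (fun x => amplitude i *
      (omega i * sin (omega i * x) - sin x / cos x * cos (omega i * x)))).
    - apply is_derive_unique. auto_derive; [lra|].
      assert (E : sin y ^ 2 = 1 - cos y ^ 2) by apply sin_sq.
      field_simplify; [|lra|lra]. rewrite E. field. lra.
    - apply (locally_open_interval 0 (PI / 2)); [exact Hy|].
      intros z Hz. now apply tan_e_interior. }
  rewrite (Derive_ext_loc _ (fun y => 
    amplitude i * (omega i ^ 2 * cos (omega i * y) - cos (omega i * y) / cos y ^ 2
                   + omega i * (sin y / cos y) * sin (omega i * y)))).
  - rewrite tan_e_interior by exact Hx.
    apply is_derive_unique. auto_derive.
    + repeat split; try exact I; try lra. apply Rgt_not_eq.
      rewrite Rmult_1_r. now apply Rmult_lt_0_compat.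
    + assert (E : sin x ^ 2 = 1 - cos x ^ 2) by apply sin_sq.
      field_simplify; [|lra|lra]. rewrite E. field. lra.
  - now apply (locally_open_interval 0 (PI / 2)).
Qed.

(** By the eigenvalue equation the Wronskian of [tan * e i] and [tan * e j] has a
    multiple of the integrand as its derivative, and it vanishes at both ends. *)
Lemma eigen_orthogonal (i j : nat) : i <> j ->
  quarter (fun x => tan_e i x * tan_e j x) = 0.
Proof.
  intros Hij.
  pose proof (smooth_tan_e (- PI) PI i) as Hi. pose proof (smooth_tan_e (- PI) PI j) as Hj.
  pose proof (smooth_Derive _ _ _ Hi) as Hi'. pose proof (smooth_Derive _ _ _ Hj) as Hj'.
  pose (Wr := fun x => Derive (tan_e i) x * tan_e j x - tan_e i x * Derive (tan_e j) x).
  assert (HW : smooth (- PI) PI Wr) by (unfold Wr; smooth_auto).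
  pose proof (quarter_derive Wr HW) as E.
  rewrite (quarter_ext _ (fun x => (omega j ^ 2 - omega i ^ 2) * (tan_e i x * tan_e j x))) in E.
  - rewrite quarter_scal in E by smooth_auto.
    unfold Wr in E. rewrite !tan_e_0, !tan_e_PI2 in E.
    apply Rmult_eq_reg_l with (omega j ^ 2 - omega i ^ 2); [lra|].
    pose proof (omega_ge_3 i). pose proof (omega_ge_3 j).
    replace (omega j ^ 2 - omega i ^ 2) with ((omega j - omega i) * (omega j + omega i)) by ring.
    apply Rmult_integral_contrapositive_currified; [|lra].
    unfold omega. intros E'. apply Hij, INR_eq. lra.
  - intros x Hx. pose proof PI_RGT_0.
    assert (Hx' : - PI < x < PI) by lra.
    transitivity (Derive (Derive (tan_e i)) x * tan_e j x
                  - tan_e i x * Derive (Derive (tan_e j)) x).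
    + apply is_derive_unique. unfold Wr. auto_derive.
      * repeat split; now apply (smooth_ex_derive (- PI) PI).
      * change (fun x => tan_e i x) with (tan_e i). change (fun x => tan_e j x) with (tan_e j).
        change (fun x => Derive (tan_e i) x) with (Derive (tan_e i)).
        change (fun x => Derive (tan_e j) x) with (Derive (tan_e j)). ring.
    + rewrite !tan_e_ode by exact Hx. ring.
Qed.

(** A constant weight gives nothing off the diagonal, so every decay rate holds. *)
Lemma decay_const (p : nat) (k : R) :
  decay p (fun i j => quarter (fun x => k * (e i x * e j x * tan x ^ 2))).
Proof.
  apply decay_ext with (fun i j => k * quarter (fun x => tan_e i x * tan_e j x)).
  - intros i j.
    pose proof (smooth_tan_e (- PI) PI i) as Hi. pose proof (smooth_tan_e (- PI) PI j) as Hj.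
    rewrite <- quarter_scal by smooth_auto. apply quarter_ext. intros x Hx.
    rewrite !tan_e_eq by exact Hx. ring.
  - apply decay_mul with (Rabs k); [intros; lra|].
    destruct tan_e_bounded as [C [HC0 HC]].
    exists (2 * (C * C)). split; [nra|split].
    + intros i j. apply quarter_bound.
      * pose proof (smooth_tan_e (- PI) PI i). pose proof (smooth_tan_e (- PI) PI j).
        smooth_auto.
      * intros x _. rewrite Rabs_mult. apply Rmult_le_compat; auto using Rabs_pos.
    + intros i j Hij. rewrite eigen_orthogonal, Rabs_R0 by lia.
      apply Rmult_le_pos; [nra|]. left. now apply inv_gap_pos.
Qed.

(** * The weights of the Fourier constants *)

Lemma de_0_closed_form (x : R) : de 0 x = - 3 * e 0 0 * (cos x ^ 2 * sin x).
Proof.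
  unfold de. rewrite (Derive_ext _ (fun x => e 0 0 * cos x ^ 3) _ e_0_closed_form).
  apply is_derive_unique. auto_derive; [exact I|]. simpl. ring.
Qed.

Lemma RInt_scaled (f g : R -> R) (k x : R) : 0 < x ->
  (forall y, 0 < y < x -> f y = k * g y) -> (forall y, continuous g y) ->
  RInt f 0 x = k * RInt g 0 x.
Proof.
  intros Hx E Hg.
  transitivity (RInt (fun y => scal k (g y)) 0 x).
  - apply RInt_ext. rewrite Rmin_left, Rmax_right by lra. exact E.
  - apply (RInt_scal (V := R_CompleteNormedModule)).
    apply (ex_RInt_continuous (V := R_CompleteNormedModule)). intros; apply Hg.
Qed.

(** [Gam3] and [Gam4] divided by [9 * e 0 0 ^ 2]. *)
Definition T3 (x : R) : R := sin x ^ 4 * ((3 * cos x ^ 4 + 2 * cos x ^ 2 + 1) / 24).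
Definition T4 (x : R) : R := sin x ^ 2 * ((1 + cos x ^ 2 + cos x ^ 4 + cos x ^ 6) / 8).

Lemma T3_eq (x : R) : T3 x = 1 / 24 - cos x ^ 6 / 6 + cos x ^ 8 / 8.
Proof.
  unfold T3. replace (sin x ^ 4) with ((1 - cos x ^ 2) ^ 2) by (rewrite <- sin_sq; ring).
  field.
Qed.

Lemma T4_eq (x : R) : T4 x = (1 - cos x ^ 8) / 8.
Proof. unfold T4. rewrite sin_sq. field. Qed.

Lemma Gam1_closed_form (x : R) : 0 < x < PI / 2 ->
  Gam1 x = 9 * e 0 0 ^ 2 * (cos x ^ 3 * sin x ^ 4 * Q1 x).
Proof.
  intros Hx. destruct (sin_cos_pos x Hx) as [Hs Hc]. unfold Gam1.
  rewrite (RInt_scaled _ (fun y => sin y ^ 4 * cos y ^ 2) (9 * e 0 0 ^ 2)) by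
    (lra || (intros y Hy; destruct (sin_cos_pos y) as [? ?]; [lra|];
             rewrite de_0_closed_form; unfold tan; field; lra)
     || (intros y; apply (smooth_continuous (y - 1) (y + 1)); [smooth_auto|lra])).
  rewrite RInt_reduced_primitive by lra. unfold Q1. field. lra.
Qed.

Lemma Gam2_closed_form (x : R) : 0 < x < PI / 2 ->
  Gam2 x = 9 * e 0 0 ^ 2 * (cos x ^ 3 * sin x ^ 2 * Q2 x).
Proof.
  intros Hx. destruct (sin_cos_pos x Hx) as [Hs Hc]. unfold Gam2.
  rewrite (RInt_scaled _ (fun y => sin y ^ 2 * cos y ^ 4) (e 0 0 ^ 2)) by
    (lra || (intros y Hy; destruct (sin_cos_pos y) as [? ?]; [lra|];
             rewrite e_0_closed_form; unfold tan; field; lra)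
     || (intros y; apply (smooth_continuous (y - 1) (y + 1)); [smooth_auto|lra])).
  rewrite RInt_reduced_primitive by lra. unfold Q2, omega. simpl INR. field. lra.
Qed.

Lemma Gam3_closed_form (x : R) : 0 < x < PI / 2 -> Gam3 x = 9 * e 0 0 ^ 2 * T3 x.
Proof.
  intros Hx. unfold Gam3. rewrite T3_eq.
  rewrite (RInt_scaled _ (fun y => cos y ^ 5 * sin y * (1 - cos y ^ 2)) (9 * e 0 0 ^ 2)) by
    (lra || (intros y Hy; rewrite de_0_closed_form, <- sin_sq; ring)
     || (intros y; apply (smooth_continuous (y - 1) (y + 1)); [smooth_auto|lra])).
  f_equal.
  apply (RInt_trig _ (fun x => 1 / 24 - cos x ^ 6 / 6 + cos x ^ 8 / 8)).
  - rewrite cos_0. field.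
  - intros y. auto_derive; [exact I|]. simpl. field.
  - intros y; apply (smooth_continuous (y - 1) (y + 1)); [smooth_auto|lra].
Qed.

Lemma Gam4_closed_form (x : R) : 0 < x < PI / 2 -> Gam4 x = 9 * e 0 0 ^ 2 * T4 x.
Proof.
  intros Hx. unfold Gam4. rewrite T4_eq.
  rewrite (RInt_scaled _ (fun y => cos y ^ 7 * sin y) (e 0 0 ^ 2)) by
    (lra || (intros y Hy; rewrite e_0_closed_form; ring)
     || (intros y; apply (smooth_continuous (y - 1) (y + 1)); [smooth_auto|lra])).
  rewrite (RInt_trig _ (fun x => (1 - cos x ^ 8) / 8)).
  - unfold omega. simpl INR. field.
  - rewrite cos_0. field.
  - intros y. auto_derive; [exact I|]. simpl. field.
  - intros y; apply (smooth_continuous (y - 1) (y + 1)); [smooth_auto|lra].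
Qed.

Lemma smooth_Q1 : smooth (- PI) PI Q1.
Proof. apply smooth_reduced_primitive. Qed.

Lemma smooth_Q2 : smooth (- PI) PI Q2.
Proof. apply smooth_reduced_primitive. Qed.

Lemma Q1_even (x : R) : Q1 (- x) = Q1 x.
Proof. apply reduced_primitive_even. Qed.

Lemma Q2_even (x : R) : Q2 (- x) = Q2 x.
Proof. apply reduced_primitive_even. Qed.

Lemma smooth_Q1_complement : smooth 0 PI (fun x => Q1 (PI / 2 - x)).
Proof.
  pose proof PI_RGT_0. apply smooth_sub with (PI / 2 - PI) (PI / 2 - - PI); [lra|lra|].
  apply smooth_reflect, smooth_Q1.
Qed.

Lemma smooth_Q2_complement : smooth 0 PI (fun x => Q2 (PI / 2 - x)).
Proof.
  pose proof PI_RGT_0. apply smooth_sub with (PI / 2 - PI) (PI / 2 - - PI); [lra|lra|].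
  apply smooth_reflect, smooth_Q2.
Qed.

(** The four parts of [weight]: two closures under the operations, and the two
    reflections as rational identities in sine, cosine, [Q1] and [Q2]. *)
Ltac weight_auto :=
  pose proof smooth_Q1; pose proof smooth_Q2;
  pose proof smooth_Q1_complement; pose proof smooth_Q2_complement;
  split; [|split; [|split]];
  [ unfold T3, T4; smooth_auto; intros; lra
  | unfold T3, T4; smooth_auto;
    intros x Hx; pose proof (sin_pos x Hx);
    lazymatch goal with |- _ ^ _ <> 0 => apply pow_nonzero | _ => idtac end; lra
  | intros x Hx; unfold T3, T4; rewrite ?Q1_even, ?Q2_even, ?sin_neg, ?cos_neg; field
  | intros x Hx; pose proof (sin_pos x Hx); unfold T3, T4;
    rewrite ?Q1_reflect, ?Q2_reflect by exact Hx; rewrite ?sin_PI_x, ?cos_PI_minus;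
    try (field; lra) ].

(** Apart from terms and factors symmetric about [PI / 2], the next weights are an odd
    power of the cosine times [1], [Q1] or [Q2]. The reflection changes the sign of the
    power, and it turns [Q1] and [Q2] into their negatives plus [PI / 16] over a power
    of the sine; [H] is what then remains next to the power of the cosine. *)
Lemma weight_C13 : weight 1 1 1
  (fun x => cos x * sin x ^ 4 * Q1 x + cos x ^ 4 / 6 - cos x ^ 6 / 8)
  (fun x => - (PI / 16) / sin x).
Proof. weight_auto. Qed.

Lemma weight_C24 : weight 1 1 1
  (fun x => cos x * sin x ^ 2 * Q2 x + cos x ^ 6 / 8) (fun x => - (PI / 16) / sin x).
Proof. weight_auto. Qed.

Lemma weight_C13bar : weight 1 1 3
  (fun x => cos x ^ 3 * sin x ^ 2 * Q1 x
            - sin x ^ 2 * ((3 * cos x ^ 4 + 2 * cos x ^ 2 + 1) / 24))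
  (fun x => - (PI / 16) / sin x ^ 3).
Proof. weight_auto. Qed.

Lemma weight_C24bar : weight 1 1 3
  (fun x => cos x ^ 3 * Q2 x - (1 + cos x ^ 2 + cos x ^ 4 + cos x ^ 6) / 8)
  (fun x => - (PI / 16) / sin x ^ 3).
Proof. weight_auto. Qed.

Lemma weight_D13 : weight 1 1 1
  (fun x => cos x * (sin x ^ 2 * Q1 x) * T3 x) (fun x => - (PI / 16) / sin x ^ 3 * T3 x).
Proof. weight_auto. Qed.

Lemma weight_D24 : weight 1 1 1
  (fun x => cos x * Q2 x * T4 x) (fun x => - (PI / 16) / sin x ^ 3 * T4 x).
Proof. weight_auto. Qed.

Lemma weight_E : weight 1 1 1
  (fun x => cos x * (sin x ^ 2 * Q1 x * T4 x + Q2 x * T3 x))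
  (fun x => - (PI / 16) / sin x ^ 3 * (T3 x + T4 x)).
Proof. weight_auto. Qed.

Lemma weight_cos_1 : weight 1 1 1 (fun x => cos x) (fun _ => -2).
Proof. weight_auto. Qed.

Lemma weight_cos_T3 : weight 1 1 1 (fun x => cos x * T3 x) (fun x => -2 * T3 x).
Proof. weight_auto. Qed.

Lemma weight_cos_T4 : weight 1 1 1 (fun x => cos x * T4 x) (fun x => -2 * T4 x).
Proof. weight_auto. Qed.

(** In the product of [Gam1] with [e 0] the two odd powers of the cosine make an even
    one, so that the constant part of the primitive no longer breaks the symmetry
    about [PI / 2]; what does is the primitive measured from [PI / 2], which vanishes
    there to third order. *)
Lemma weight_Gam1 : weight 1 1 7
  (fun x => cos x ^ 4 * sin x ^ 4 * Q1 x) (fun x => 2 * Q2 (PI / 2 - x) / sin x).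
Proof.
  weight_auto. pose proof (Q1_complement x Hx) as E.
  transitivity (cos x ^ 4 * sin x ^ 4 * Q1 x
    + cos x ^ 4 / sin x * (PI / 16 - 2 * (sin x ^ 5 * Q1 x))); [field; lra|].
  rewrite E. field. lra.
Qed.

(** As for [Gam1], with a primitive vanishing to fifth order. *)
Lemma weight_Gam2 : weight 1 1 9
  (fun x => cos x ^ 4 * sin x ^ 2 * Q2 x) (fun x => 2 * Q1 (PI / 2 - x) / sin x).
Proof.
  weight_auto. pose proof (Q2_complement x Hx) as E.
  transitivity (cos x ^ 4 * sin x ^ 2 * Q2 x
    + cos x ^ 4 / sin x * (PI / 16 - 2 * (sin x ^ 3 * Q2 x))); [field; lra|].
  rewrite E. field. lra.
Qed.

(** * The estimates *)

Lemma estimate_a_eigen n (c : R) F B H X :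
  weight 1 1 n B H -> (forall x, 0 < x < PI / 2 -> F x = c * (cos x ^ 2 * B x)) ->
  (forall i j, X i j = quarter (fun x => F x * (e i x * e j x * tan x ^ 2))) ->
  estimate_a (n + 3) X.
Proof.
  intros HB HF HX. apply estimate_a_of_decay.
  apply decay_ext with (1 := fun i j => eq_sym (HX i j)).
  apply decay_eigen with (1 := weight_mul_scal c _ _ _ _ _ HB).
  intros x Hx. rewrite HF by exact Hx. ring.
Qed.

(** A constant in the weight does not vanish at [PI / 2], where the tangent is
    singular, and is left to orthogonality. *)
Lemma estimate_a_eigen_const n (c k : R) F B H X :
  weight 1 1 n B H -> (forall x, 0 < x < PI / 2 -> F x = c * (k + cos x ^ 2 * B x)) ->
  (forall i j, X i j = quarter (fun x => F x * (e i x * e j x * tan x ^ 2))) ->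
  estimate_a (n + 3) X.
Proof.
  intros HB HF HX. apply estimate_a_of_decay.
  apply decay_ext with (fun i j =>
    quarter (fun x => c * (cos x ^ 2 * B x) * (e i x * e j x * tan x ^ 2))
    + quarter (fun x => c * k * (e i x * e j x * tan x ^ 2))).
  - intros i j. rewrite HX. pose proof (weight_smooth _ _ _ _ _ HB).
    pose proof (smooth_tan_e (- PI) PI i). pose proof (smooth_tan_e (- PI) PI j).
    rewrite (quarter_ext (fun x => c * (cos x ^ 2 * B x) * (e i x * e j x * tan x ^ 2))
               (fun x => c * (cos x ^ 2 * B x) * (tan_e i x * tan_e j x))),
      (quarter_ext (fun x => c * k * (e i x * e j x * tan x ^ 2))
               (fun x => c * k * (tan_e i x * tan_e j x)))
      by (intros x Hx; rewrite !tan_e_eq by exact Hx; ring).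
    rewrite <- quarter_plus by smooth_auto.
    apply quarter_ext. intros x Hx. rewrite HF, !tan_e_eq by exact Hx. ring.
  - apply decay_plus; [|apply decay_const].
    apply decay_eigen with (1 := weight_mul_scal c _ _ _ _ _ HB).
    intros x Hx. ring.
Qed.

Lemma estimate_a_derivative n (c : R) F B H X :
  weight 1 1 n B H -> (forall x, 0 < x < PI / 2 -> F x = c * (sin x ^ 2 * B x)) ->
  (forall i j, X i j = quarter (fun x =>
     F x * (de i x / omega i * (de j x / omega j) * tan x ^ 2))) ->
  estimate_a (n + 1) X.
Proof.
  intros HB HF HX. apply estimate_a_of_decay.
  apply decay_ext with (1 := fun i j => eq_sym (HX i j)).
  apply decay_eigen_derivative with (1 := weight_mul_scal c _ _ _ _ _ HB).
  intros x Hx. rewrite HF by exact Hx. ring.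
Qed.

Lemma estimate_b_derivative n (c : R) F B H X :
  weight 1 1 n B H -> (forall x, 0 < x < PI / 2 -> F x = c * (sin x ^ 2 * B x)) ->
  (forall i j, X i j = quarter (fun x =>
     F x * (de i x / omega i * (de j x / omega j) * tan x ^ 2))) ->
  estimate_b (n + 1) (fun i j => omega 0 * X i j / omega i).
Proof.
  intros HB HF HX. apply estimate_b_of_decay.
  apply decay_ext with (fun i j => omega 0 * X i j).
  - intros i j. pose proof (omega_ge_3 i). field. lra.
  - apply decay_mul with (Rabs (omega 0)); [intros; lra|].
    apply decay_ext with (1 := fun i j => eq_sym (HX i j)).
    apply decay_eigen_derivative with (1 := weight_mul_scal c _ _ _ _ _ HB).
    intros x Hx. rewrite HF by exact Hx. ring.
Qed.

Lemma estimate_b_primitive n (c : R) F B H X :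
  weight 1 1 n B H -> (forall x, 0 < x < PI / 2 -> F x = c * (sin x ^ 2 * B x)) ->
  (forall i j, X i j = quarter (fun x => F x *
     (de j x / omega j * tan x * RInt (fun y => e i y * sin y * cos y) x (PI / 2)))) ->
  estimate_b (n + 3) (fun i j => omega 0 * X i j).
Proof.
  intros HB HF HX. apply estimate_b_of_decay.
  pose (D := fun i j => omega i * X i j).
  apply decay_ext with (fun i j => omega 0 * D i j); [unfold D; intros; ring|].
  apply decay_mul with (Rabs (omega 0)); [intros; lra|].
  apply decay_ext with (1 := fun i j => f_equal (Rmult (omega i)) (eq_sym (HX i j))).
  apply decay_eigen_primitive with (1 := weight_mul_scal c _ _ _ _ _ HB).
  intros x Hx. rewrite HF by exact Hx. ring.
Qed.

Lemma first_nonvanishing_scaled n (c : R) F W H :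
  c <> 0 -> weight 1 1 n W H -> Nat.Odd n -> H (PI / 2) <> 0 ->
  (forall x, 0 < x < PI / 2 -> F x = c * W x) -> first_nonvanishing n F.
Proof.
  intros Hc HW Hn HH HF.
  apply weight_first_nonvanishing with (1 := weight_mul_scal c _ _ _ _ _ HW); auto.
Qed.

Lemma Q1_PI2_complement : 0 < Q1 (PI / 2 - PI / 2).
Proof. rewrite Rminus_diag. apply reduced_primitive_0_gt_0. Qed.

Lemma Q2_PI2_complement : 0 < Q2 (PI / 2 - PI / 2).
Proof. rewrite Rminus_diag. apply reduced_primitive_0_gt_0. Qed.

(** Replaces the coupling functions and the first eigenfunction by their closed
    forms and compares trigonometric expressions on the open interval. *)
Ltac coupling_eq :=
  intros x Hx; destruct (sin_cos_pos x Hx); simpl Gam; unfold tan;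
  rewrite ?Gam1_closed_form, ?Gam2_closed_form, ?Gam3_closed_form, ?Gam4_closed_form
    by exact Hx;
  rewrite ?(de_0_closed_form x); try rewrite (e_0_closed_form x);
  pose proof (omega_ge_3 0); try (field; lra).

Ltac integrand_eq :=
  intros i j; apply quarter_ext;
  intros x Hx; destruct (sin_cos_pos x Hx);
  simpl Gam; unfold tan;
  pose proof (omega_ge_3 0); pose proof (omega_ge_3 i); pose proof (omega_ge_3 j);
  try (field; lra).

Ltac boundary_neq_0 :=
  pose proof e_0_0_neq_0; pose proof PI_RGT_0;
  pose proof Q1_PI2_complement; pose proof Q2_PI2_complement;
  unfold T3, T4; rewrite ?sin_PI2, ?cos_PI2, ?pow1;
  try (intros E; field_simplify in E; lra).

Lemma coupling_constant_neq_0 (r : R) (n : nat) : r <> 0 -> r * e 0 0 ^ n <> 0.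
Proof.
  intros Hr. apply Rmult_integral_contrapositive_currified; [exact Hr|].
  apply pow_nonzero, e_0_0_neq_0.
Qed.

Ltac estimate_by L n c F W :=
  apply (L n c F) with (1 := W); [coupling_eq|integrand_eq].

Ltac nonvanishing_by n c W k :=
  apply (first_nonvanishing_scaled n c) with (2 := W);
  [ now apply coupling_constant_neq_0; lra | now exists k | boundary_neq_0
  | coupling_eq; unfold T3, T4; try field ].

Theorem proposition4p1 :
  ( estimate_a 4 (fun i j => fourC g1 g3 j i)
    /\ estimate_a 4 (fun i j => fourCbar g1 g3 j i)
    /\ estimate_a 4 (fun i j => fourC g2 g4 j i)
    /\ estimate_a 4 (fun i j => fourCbar g2 g4 j i)
    /\ estimate_a 4 (fun i j => fourD g1 g3 j i)
    /\ estimate_a 4 (fun i j => fourDbar g1 g3 j i)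
    /\ estimate_a 4 (fun i j => fourD g2 g4 j i)
    /\ estimate_a 4 (fun i j => fourDbar g2 g4 j i)
    /\ estimate_a 4 (fun i j => fourE1423 j i)
    /\ estimate_a 4 (fun i j => fourE1423bar j i)
    /\ estimate_a 4 (fun i j => fourG 0 j i)
    /\ estimate_a 10 (fun i j => fourF g1 0 j i)
    /\ estimate_a 12 (fun i j => fourF g2 0 j i)
    /\ estimate_a 4 (fun i j => fourF g3 0 j i)
    /\ estimate_a 4 (fun i j => fourF g4 0 j i) )
  /\
  ( estimate_b 10 (fun i j => omega 0 * fourPbar g1 0 j i)
    /\ estimate_b 10 (fun i j => omega 0 * fourP g1 0 j i / omega i)
    /\ estimate_b 12 (fun i j => omega 0 * fourPbar g2 0 j i)
    /\ estimate_b 12 (fun i j => omega 0 * fourP g2 0 j i / omega i)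
    /\ estimate_b 4 (fun i j => omega 0 * fourPbar g3 0 j i)
    /\ estimate_b 4 (fun i j => omega 0 * fourP g3 0 j i / omega i)
    /\ estimate_b 4 (fun i j => omega 0 * fourPbar g4 0 j i)
    /\ estimate_b 4 (fun i j => omega 0 * fourP g4 0 j i / omega i)
    /\ estimate_b 4 (fun i j => omega 0 * fourJbar 0 j i)
    /\ estimate_b 4 (fun i j => omega 0 * fourJ 0 j i / omega i) )
  /\
  ( first_nonvanishing 3 (fun x => Gam g1 x - Gam g3 x)
    /\ first_nonvanishing 3 (fun x => Gam g2 x - Gam g4 x)
    /\ first_nonvanishing 3 (fun x => Gam g1 x * Gam g3 x)
    /\ first_nonvanishing 3 (fun x => Gam g2 x * Gam g4 x)
    /\ first_nonvanishing 3 (fun x => Gam g1 x * Gam g4 x + Gam g2 x * Gam g3 x)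
    /\ first_nonvanishing 3 (e 0)
    /\ first_nonvanishing 3 (fun x => Gam g3 x * e 0 x)
    /\ first_nonvanishing 3 (fun x => Gam g4 x * e 0 x)
    /\ first_nonvanishing 3 (fun x => Gam g3 x * de 0 x * sin x * cos x)
    /\ first_nonvanishing 3 (fun x => Gam g4 x * de 0 x * sin x * cos x)
    /\ first_nonvanishing 3 (fun x => de 0 x * sin x * cos x)
    /\ first_nonvanishing 9 (fun x => Gam g1 x * e 0 x)
    /\ first_nonvanishing 9 (fun x => Gam g1 x * de 0 x * sin x * cos x)
    /\ first_nonvanishing 11 (fun x => Gam g2 x * e 0 x)
    /\ first_nonvanishing 11 (fun x => Gam g2 x * de 0 x * sin x * cos x) ).
Proof.
  repeat match goal with |- _ /\ _ => split end.
  - apply (estimate_a_eigen_const 1 (9 * e 0 0 ^ 2) (- (1 / 24))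
      (fun x => Gam g1 x - Gam g3 x)) with (1 := weight_C13).
    + coupling_eq. rewrite T3_eq. field.
    + integrand_eq.
  - estimate_by estimate_a_derivative 3%nat (9 * e 0 0 ^ 2)
      (fun x => Gam g1 x - Gam g3 x) weight_C13bar. unfold T3. field.
  - apply (estimate_a_eigen_const 1 (9 * e 0 0 ^ 2) (- (1 / 8))
      (fun x => Gam g2 x - Gam g4 x)) with (1 := weight_C24).
    + coupling_eq. rewrite T4_eq. field.
    + integrand_eq.
  - estimate_by estimate_a_derivative 3%nat (9 * e 0 0 ^ 2)
      (fun x => Gam g2 x - Gam g4 x) weight_C24bar. unfold T4. field.
  - estimate_by estimate_a_eigen 1%nat (81 * e 0 0 ^ 4)
      (fun x => Gam g1 x * Gam g3 x)
      (weight_sin_sin _ _ _ weight_D13).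
  - estimate_by estimate_a_derivative 3%nat (81 * e 0 0 ^ 4)
      (fun x => Gam g1 x * Gam g3 x)
      (weight_cos_cos _ _ _ weight_D13).
  - estimate_by estimate_a_eigen 1%nat (81 * e 0 0 ^ 4)
      (fun x => Gam g2 x * Gam g4 x)
      (weight_sin_sin _ _ _ weight_D24).
  - estimate_by estimate_a_derivative 3%nat (81 * e 0 0 ^ 4)
      (fun x => Gam g2 x * Gam g4 x)
      (weight_cos_cos _ _ _ weight_D24).
  - estimate_by estimate_a_eigen 1%nat (81 * e 0 0 ^ 4)
      (fun x => Gam g1 x * Gam g4 x + Gam g2 x * Gam g3 x)
      (weight_sin_sin _ _ _ weight_E).
  - estimate_by estimate_a_derivative 3%nat (81 * e 0 0 ^ 4)
      (fun x => Gam g1 x * Gam g4 x + Gam g2 x * Gam g3 x)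
      (weight_cos_cos _ _ _ weight_E).
  - estimate_by estimate_a_eigen 1%nat (e 0 0) (e 0) weight_cos_1.
  - estimate_by estimate_a_eigen 7%nat (9 * e 0 0 ^ 3) (fun x => Gam g1 x * e 0 x) weight_Gam1.
  - estimate_by estimate_a_eigen 9%nat (9 * e 0 0 ^ 3) (fun x => Gam g2 x * e 0 x) weight_Gam2.
  - estimate_by estimate_a_eigen 1%nat (9 * e 0 0 ^ 3) (fun x => Gam g3 x * e 0 x) weight_cos_T3.
  - estimate_by estimate_a_eigen 1%nat (9 * e 0 0 ^ 3) (fun x => Gam g4 x * e 0 x) weight_cos_T4.
  - estimate_by estimate_b_primitive 7%nat (- 27 * e 0 0 ^ 3 / omega 0)
      (fun x => Gam g1 x * (de 0 x / omega 0) * tan x) weight_Gam1.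
  - estimate_by estimate_b_derivative 9%nat (- 27 * e 0 0 ^ 3 / omega 0)
      (fun x => Gam g1 x * (de 0 x / omega 0) * sin x * cos x)
      (weight_cos_cos _ _ _ weight_Gam1).
  - estimate_by estimate_b_primitive 9%nat (- 27 * e 0 0 ^ 3 / omega 0)
      (fun x => Gam g2 x * (de 0 x / omega 0) * tan x) weight_Gam2.
  - estimate_by estimate_b_derivative 11%nat (- 27 * e 0 0 ^ 3 / omega 0)
      (fun x => Gam g2 x * (de 0 x / omega 0) * sin x * cos x)
      (weight_cos_cos _ _ _ weight_Gam2).
  - estimate_by estimate_b_primitive 1%nat (- 27 * e 0 0 ^ 3 / omega 0)
      (fun x => Gam g3 x * (de 0 x / omega 0) * tan x) weight_cos_T3.
  - estimate_by estimate_b_derivative 3%nat (- 27 * e 0 0 ^ 3 / omega 0)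
      (fun x => Gam g3 x * (de 0 x / omega 0) * sin x * cos x)
      (weight_cos_cos _ _ _ weight_cos_T3).
  - estimate_by estimate_b_primitive 1%nat (- 27 * e 0 0 ^ 3 / omega 0)
      (fun x => Gam g4 x * (de 0 x / omega 0) * tan x) weight_cos_T4.
  - estimate_by estimate_b_derivative 3%nat (- 27 * e 0 0 ^ 3 / omega 0)
      (fun x => Gam g4 x * (de 0 x / omega 0) * sin x * cos x)
      (weight_cos_cos _ _ _ weight_cos_T4).
  - estimate_by estimate_b_primitive 1%nat (- 3 * e 0 0 / omega 0)
      (fun x => de 0 x / omega 0 * tan x) weight_cos_1.
  - estimate_by estimate_b_derivative 3%nat (- 3 * e 0 0 / omega 0)
      (fun x => de 0 x / omega 0 * sin x * cos x) (weight_cos_cos _ _ _ weight_cos_1).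
  - nonvanishing_by 3%nat (9 * e 0 0 ^ 2) (weight_sin_sin _ _ _ weight_C13bar) 1%nat.
  - nonvanishing_by 3%nat (9 * e 0 0 ^ 2) (weight_sin_sin _ _ _ weight_C24bar) 1%nat.
  - nonvanishing_by 3%nat (81 * e 0 0 ^ 4) (weight_sin2_cos2 _ _ _ weight_D13) 1%nat.
  - nonvanishing_by 3%nat (81 * e 0 0 ^ 4) (weight_sin2_cos2 _ _ _ weight_D24) 1%nat.
  - nonvanishing_by 3%nat (81 * e 0 0 ^ 4) (weight_sin2_cos2 _ _ _ weight_E) 1%nat.
  - nonvanishing_by 3%nat (1 * e 0 0 ^ 1) (weight_cos_cos _ _ _ weight_cos_1) 1%nat.
  - nonvanishing_by 3%nat (9 * e 0 0 ^ 3) (weight_cos_cos _ _ _ weight_cos_T3) 1%nat.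
  - nonvanishing_by 3%nat (9 * e 0 0 ^ 3) (weight_cos_cos _ _ _ weight_cos_T4) 1%nat.
  - nonvanishing_by 3%nat (- 27 * e 0 0 ^ 3) (weight_sin2_cos2 _ _ _ weight_cos_T3) 1%nat.
  - nonvanishing_by 3%nat (- 27 * e 0 0 ^ 3) (weight_sin2_cos2 _ _ _ weight_cos_T4) 1%nat.
  - nonvanishing_by 3%nat (- 3 * e 0 0 ^ 1) (weight_sin2_cos2 _ _ _ weight_cos_1) 1%nat.
  - nonvanishing_by 9%nat (9 * e 0 0 ^ 3) (weight_cos_cos _ _ _ weight_Gam1) 4%nat.
  - nonvanishing_by 9%nat (- 27 * e 0 0 ^ 3) (weight_sin2_cos2 _ _ _ weight_Gam1) 4%nat.
  - nonvanishing_by 11%nat (9 * e 0 0 ^ 3) (weight_cos_cos _ _ _ weight_Gam2) 5%nat.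
  - nonvanishing_by 11%nat (- 27 * e 0 0 ^ 3) (weight_sin2_cos2 _ _ _ weight_Gam2) 5%nat.
Qed.
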